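(* Let $\mathcal{H}$ be a complex Hilbert space and $T\in\mathcal{B}(\mathcal{H})$. Let $f$ and $g$ be non-negative continuous functions on $[0,\infty)$ satisfying $f(t)g(t)=t$ for all $t\ge 0$. Then: (i) for all real $\alpha,\beta\ge 0$ with $(\alpha,\beta)\ne(0,0)$, $$\|T\|_{\alpha,\beta}^2\le \left\|\frac{\alpha}{4}\left(f^2(|T|)+g^2(|T^*|)\right)^2+\beta T^*T\right\|;$$ (ii) $$w(T)\le \inf_{\alpha,\beta}\frac{1}{\sqrt{\alpha+\beta}}\left\|\frac{\alpha}{4}(|T|+|T^*|)^2+\beta T^*T\right\|^{\frac12}\le \frac12\big\|\,|T|+|T^*|\,\big\|,$$ where the infimum is over all real $\alpha,\beta\ge0$ with $(\alpha,\beta)\neq(0,0)$.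
   Context: $\mathcal{B}(\mathcal{H})$ is the $C^*$-algebra of bounded linear operators on $\mathcal{H}$. $|T|=(T^*T)^{1/2}$. Functions of positive operators are defined by continuous functional calculus. $w(T)=\sup\{|\langle Tx,x\rangle|: \|x\|=1\}$ is the numerical radius, $\|T\|$ the operator norm, and $\|T\|_{\alpha,\beta}=\sup\left\{\sqrt{\alpha|\langle Tx,x\rangle|^2+\beta\|Tx\|^2}: x\in\mathcal{H},\|x\|=1\right\}$. *)

(* Defs.v *)
From HB Require Import structures.
From mathcomp Require Import all_boot all_order all_algebra.
From mathcomp Require Import all_classical all_reals all_analysis.
From mathcomp Require Import complex.

Set Implicit Arguments.
Unset Strict Implicit.
Unset Printing Implicit Defensive.

Import Order.TTheory GRing.Theory Num.Theory.
Import numFieldNormedType.Exports.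

Local Open Scope classical_set_scope.
Local Open Scope complex_scope.
Local Open Scope ring_scope.

(* A complex Hilbert space is a complete normed space over R[i] whose norm is
   induced by an inner product.  In MathComp, [{dot H for theta}] is linear in
   its first argument, theta-linear in its second one, hermitian and positive
   definite.  The zero space is allowed. *)
HB.mixin Record isHilbert (R : realType) H of CompleteNormedModule R[i] H := {
  inner : {dot H for (@Num.conj R[i])};
  inner_norm : forall x : H, `|x| ^+ 2 = inner x x
}.

#[short(type="hilbertType")]
HB.structure Definition Hilbert (R : realType) :=
  {H of CompleteNormedModule R[i] H & isHilbert R H}.

(* In MathComp-Analysis the norm of a complex normed space takes its values in
   the nonnegative reals of R[i]; [rnorm] is the same norm, with values in R.
   It also serves as the modulus on R[i]. *)
Definition rnorm (R : realType) (V : normedZmodType R[i]) (v : V) : R :=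
  complex.Re `|v|.

Section operators.
Variables (R : realType) (H : hilbertType R).
Implicit Types (A T : H -> H).

Definition bounded_operator A : Prop := linear A /\ continuous A.

Definition opnorm A : R :=
  sup [set rnorm (A x) | x in [set x : H | rnorm x <= 1]].

Definition numerical_radius T : R :=
  sup [set rnorm (inner (T x) x : R[i]) | x in [set x : H | rnorm x = 1]].

Definition alpha_beta_norm (a b : R) T : R :=
  sup [set Num.sqrt (a * rnorm (inner (T x) x : R[i]) ^+ 2 + b * rnorm (T x) ^+ 2)
      | x in [set x : H | rnorm x = 1]].

(* The unique S with <T x, y> = <x, S y>. *)
Definition adjoint T : H -> H :=
  get [set S : H -> H | forall x y, inner (T x) y = inner x (S y)].

Definition spectrum A : set R[i]^o :=
  [set z | ~ exists B : H -> H, [/\ bounded_operator B,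
     forall x, B (A x - z *: x) = x & forall x, A (B x) - z *: B x = x]].

(* [is_calculus A Phi]: Phi is a unital *-homomorphism from C(spectrum A) to
   B(H) that maps the inclusion of spectrum A in R[i] to A.  An element of
   C(spectrum A) is represented by any function on R[i] that restricts to it;
   [calculus_ext] makes Phi independent of the representative. *)
Definition spectrum_continuous A (h : R[i]^o -> R[i]^o) : Prop :=
  {within spectrum A, continuous h}.

Record is_calculus A (Phi : (R[i]^o -> R[i]^o) -> H -> H) : Prop := IsCalculus {
  calculus_bounded : forall h, spectrum_continuous A h ->
    bounded_operator (Phi h);
  calculus_ext : forall h k,
    spectrum_continuous A h -> spectrum_continuous A k ->
    (forall z, spectrum A z -> h z = k z) -> Phi h = Phi k;
  calculus_1 : Phi (fun=> 1) = idfun;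
  calculus_id : Phi (fun z => z) = A;
  calculus_D : forall h k,
    spectrum_continuous A h -> spectrum_continuous A k ->
    Phi (fun z => h z + k z) = (fun x => Phi h x + Phi k x);
  calculus_Z : forall (c : R[i]) h, spectrum_continuous A h ->
    Phi (fun z => c * h z) = (fun x => c *: Phi h x);
  calculus_M : forall h k,
    spectrum_continuous A h -> spectrum_continuous A k ->
    Phi (fun z => h z * k z) = Phi h \o Phi k;
  calculus_conj : forall h, spectrum_continuous A h ->
    Phi (fun z => (h z)^*) = adjoint (Phi h)
}.

Definition calculus A : (R[i]^o -> R[i]^o) -> H -> H :=
  get [set Phi | is_calculus A Phi].

(* f(A) for a positive operator A and a continuous f on [0, +oo[ : as the
   spectrum of A is contained in [0, +oo[, only the values of f there matter. *)
Definition real_calculus A (f : R -> R) : H -> H :=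
  calculus A (fun z => (f (complex.Re z))%:C).

Definition absop T : H -> H := real_calculus (adjoint T \o T) Num.sqrt.

End operators.

(* Main.v *)
(* With |<T x, x>| <= |f(|T|) x| |g(|T^*|) x| (the mixed Schwarz inequality of
   Kittaneh) and AM-GM, |<T x, x>| <= <A x, x> / 2 <= |A x| / 2 for the operator
   A = f^2(|T|) + g^2(|T^*|) and unit x; so a |<T x, x>|^2 + b |T x|^2 is at most
   <(a / 4 A^2 + b T^* T) x, x>, which gives (i), and (ii) follows with f = g =
   sqrt and |<T x, x>| <= |T x|.

   The continuous functional calculus of a positive operator A is obtained from
   polynomials: on the spectrum, a compact subset of [0, +oo[, every continuous
   function is a uniform limit of Bernstein polynomials p, and |p| <= c there
   implies |p(A)| <= c.  All existence statements (adjoints, inverses) come from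
   minimizing |S x|^2 - 2 Re (phi x). *)

Require Import Defs.
From HB Require Import structures.
From mathcomp Require Import all_boot all_order all_algebra.
From mathcomp Require Import all_classical all_reals all_analysis.
From mathcomp Require Import complex ring lra.

Set Implicit Arguments.
Unset Strict Implicit.
Unset Printing Implicit Defensive.

Import Order.TTheory GRing.Theory Num.Theory.
Import numFieldNormedType.Exports.

Local Open Scope classical_set_scope.
Local Open Scope complex_scope.
Local Open Scope ring_scope.

(** * Norm and inner product *)

(** [adjoint] and [calculus] are chosen by [get]: each becomes usable only once some object with the
    defining property has been built, and then only through that property. Bounds on [calculus A]
    are therefore derived for an arbitrary [Phi] satisfying [is_calculus].

    The link between values on the spectrum and operator bounds is that the infimum of the numerical
    range of a selfadjoint operator is a spectral value. Applied to a polynomial in A, whose factors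
    [A - z] over R[i] can be treated one by one, it carries a bound of |p| on the spectrum over to
    p(A).

    The mixed Schwarz inequality needs g to pass from |T| to |T^*|. Bracketing T T^* T in two ways
    gives this for polynomials in T^* T and T T^*, then by approximation for |T| and |T^*|, then for
    g.

    In (ii) the second inequality is the value at the weight (1, 0). On the zero space spectra and
    unit spheres are empty, and a supremum over the empty set is 0. *)

Section Rnorm.
Variables (R : realType) (V : normedZmodType R[i]).
Implicit Types x y : V.

Lemma rnormE x : `|x| = (rnorm x)%:C.
Proof.
by rewrite /rnorm; have := ger0_Im (normr_ge0 x); case: `|x| => a b /= ->.
Qed.

Lemma rnorm_ge0 x : 0 <= rnorm x.
Proof. by rewrite -ler0c -rnormE. Qed.

Lemma rnorm_eq0 x : (rnorm x == 0) = (x == 0).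
Proof. by rewrite -(normr_eq0 x) rnormE eq_complex /= eqxx andbT. Qed.

Lemma rnorm0 : rnorm (0 : V) = 0.
Proof. by apply/eqP; rewrite rnorm_eq0. Qed.

Lemma rnorm_gt0 x : (0 < rnorm x) = (x != 0).
Proof. by rewrite lt_neqAle rnorm_ge0 andbT eq_sym rnorm_eq0. Qed.

Lemma rnormN x : rnorm (- x) = rnorm x.
Proof. by rewrite /rnorm normrN. Qed.

Lemma rnormD x y : rnorm (x + y) <= rnorm x + rnorm y.
Proof. by rewrite -lecR rmorphD /= -!rnormE ler_normD. Qed.

Lemma rnormB x y : rnorm (x - y) <= rnorm x + rnorm y.
Proof. by rewrite (le_trans (rnormD _ _)) // rnormN. Qed.

Lemma rdistC x y : rnorm (x - y) = rnorm (y - x).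
Proof. by rewrite -rnormN opprB. Qed.

Lemma rdistD z x y : rnorm (x - y) <= rnorm (x - z) + rnorm (z - y).
Proof. by rewrite (le_trans _ (rnormD _ _)) // addrA subrK. Qed.

Lemma rnorm_lerBr x y : rnorm x - rnorm y <= rnorm (x - y).
Proof. by rewrite lerBlDr -{1}(subrK y x) rnormD. Qed.

End Rnorm.

Lemma rnormZ (R : realType) (V : normedModType R[i]) (a : R[i]) (x : V) :
  rnorm (a *: x) = rnorm a * rnorm x.
Proof. by apply: complexI; rewrite rmorphM /= -!rnormE normrZ. Qed.

Section RnormC.
Variable R : realType.
Implicit Types (z w : R[i]) (t : R).

Lemma rnormM z w : rnorm (z * w) = rnorm z * rnorm w.
Proof. by apply: complexI; rewrite rmorphM /= -!rnormE normrM. Qed.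

Lemma rnorm1 : rnorm (1 : R[i]) = 1.
Proof. by rewrite /rnorm normr1. Qed.

Lemma rnorm_real t : rnorm (t%:C : R[i]) = `|t|.
Proof. by rewrite /rnorm normc_def /= expr0n addr0 sqrtr_sqr. Qed.

Lemma rnorm_conj z : rnorm (z^*) = rnorm z.
Proof. by rewrite /rnorm norm_conjC. Qed.

Lemma sqr_rnorm z : (rnorm z ^+ 2)%:C = z * z^*.
Proof. by rewrite rmorphXn /= -rnormE normCK. Qed.

Lemma conj_real t : (t%:C : R[i])^* = t%:C.
Proof. exact: conjc_real. Qed.

Lemma Re_rnorm z : `|complex.Re z| <= rnorm z.
Proof. by rewrite -lecR -rnormE normc_ge_Re. Qed.

Lemma Im_rnorm z : `|complex.Im z| <= rnorm z.
Proof.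
by rewrite /rnorm normc_def /= -sqrtr_sqr ler_wsqrtr // lerDr sqr_ge0.
Qed.

End RnormC.

Section Inner.
Variables (R : realType) (H : hilbertType R).
Implicit Types x y z : H.

Lemma innerDl x y z : inner (x + y) z = inner x z + inner y z :> R[i].
Proof. exact: linearDl. Qed.

Lemma innerDr x y z : inner x (y + z) = inner x y + inner x z :> R[i].
Proof. exact: linearDr. Qed.

Lemma innerNl x y : inner (- x) y = - inner x y :> R[i].
Proof. exact: linearNl. Qed.

Lemma innerNr x y : inner x (- y) = - inner x y :> R[i].
Proof. exact: linearNr. Qed.

Lemma innerBl x y z : inner (x - y) z = inner x z - inner y z :> R[i].
Proof. by rewrite innerDl innerNl. Qed.

Lemma innerBr x y z : inner x (y - z) = inner x y - inner x z :> R[i].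
Proof. by rewrite innerDr innerNr. Qed.

Lemma innerZl (a : R[i]) x y : inner (a *: x) y = a * inner x y :> R[i].
Proof. exact: linearZl_LR. Qed.

Lemma innerZr (a : R[i]) x y : inner x (a *: y) = a^* * inner x y :> R[i].
Proof. exact: linearZr_LR. Qed.

Lemma innerC x y : inner x y = (inner y x)^* :> R[i].
Proof. by rewrite hermC expr0 mul1r. Qed.

Lemma inner0l y : inner 0 y = 0 :> R[i].
Proof. exact: linear0l. Qed.

Lemma inner0r y : inner y 0 = 0 :> R[i].
Proof. exact: linear0r. Qed.

Lemma inner_self x : inner x x = (rnorm x ^+ 2)%:C :> R[i].
Proof. by rewrite -inner_norm rnormE rmorphXn. Qed.

Lemma rnorm_sqr x : rnorm x ^+ 2 = complex.Re (inner x x : R[i]).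
Proof. by rewrite inner_self. Qed.

Lemma inner_eq x y : (forall z, inner z x = inner z y :> R[i]) -> x = y.
Proof.
move=> eq_xy; apply/eqP; rewrite -subr_eq0 -rnorm_eq0 -sqrf_eq0 rnorm_sqr.
by rewrite innerBr eq_xy subrr.
Qed.

Lemma sqr_rnormD x y :
  rnorm (x + y) ^+ 2 =
    rnorm x ^+ 2 + rnorm y ^+ 2 + 2 * complex.Re (inner x y : R[i]).
Proof.
rewrite !rnorm_sqr innerDl !innerDr (innerC y x).
case: (inner x x : R[i]) (inner y y : R[i]) (inner x y : R[i]).
by move=> a a' [b b'] [c c'] /=; ring.
Qed.

(** The inequality is [|y|^2 (|y|^2 |x|^2 - |w|^2) >= 0] with [w = <x, y>], which is the squared
    norm of [|y|^2 x - w y]; scaling by [|y|^2] avoids a division in R[i]. *)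
Lemma Cauchy_Schwarz x y : rnorm (inner x y : R[i]) <= rnorm x * rnorm y.
Proof.
have [->|y0] := eqVneq y 0; first by rewrite inner0r !rnorm0 mulr0.
have ny0 : 0 < rnorm y by rewrite rnorm_gt0.
set w : R[i] := inner x y.
have := sqr_ge0 (rnorm ((rnorm y ^+ 2)%:C *: x - w *: y)).
rewrite (rnorm_sqr (_ - _)) !(innerBl, innerBr, innerZl, innerZr) -/w (innerC y x) -/w.
rewrite !inner_self conj_real.
have -> : (rnorm y ^+ 2)%:C * ((rnorm y ^+ 2)%:C * (rnorm x ^+ 2)%:C - w^* * w)
    - w * ((rnorm y ^+ 2)%:C * w^* - w^* * (rnorm y ^+ 2)%:C) =
    (rnorm y ^+ 2 * (rnorm y ^+ 2 * rnorm x ^+ 2 - rnorm w ^+ 2))%:C.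
  rewrite (rmorphM (real_complex R) (rnorm y ^+ 2)) rmorphB /= (sqr_rnorm w).
  by rewrite (rmorphM (real_complex R) (rnorm y ^+ 2)); ring.
rewrite /= pmulr_rge0 ?exprn_gt0 // subr_ge0 -exprMn mulrC.
by rewrite ler_pXn2r // nnegrE ?mulr_ge0 ?rnorm_ge0.
Qed.

Lemma rnorm_unit x : x != 0 -> rnorm ((rnorm x)^-1%:C *: x) = 1.
Proof.
rewrite -rnorm_gt0 => x0.
by rewrite rnormZ rnorm_real gtr0_norm ?invr_gt0 // mulVf ?gt_eqF.
Qed.

End Inner.

(** * Continuity, completeness and boundedness with epsilons in R *)

Lemma gt0_realC (R : realType) (e : R[i]) :
  0 < e -> exists2 d : R, 0 < d & e = d%:C.
Proof.
move=> e0; have e_real : e \is Num.real by rewrite gtr0_real.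
exists (complex.Re e); last by rewrite RRe_real.
by rewrite -ltcR RRe_real.
Qed.

Definition opbound (R : realType) (V W : normedZmodType R[i]) (A : V -> W)
  (C : R) := forall x, rnorm (A x) <= C * rnorm x.

Section EpsilonDelta.
Variables (R : realType) (V W : normedModType R[i]).

Lemma within_continuousP (D : set V) (f : V -> W) :
  {within D, continuous f} <->
  forall x, D x -> forall e : R, 0 < e -> exists2 d : R, 0 < d &
    forall y, D y -> rnorm (x - y) < d -> rnorm (f x - f y) < e.
Proof.
rewrite subspace_continuousP; split=> fc x Dx.
  move=> e e0; have /cvgrPdist_lt /(_ e%:C) := fc x Dx.
  rewrite ltcR => /(_ e0) /nbhs_normP [_ /gt0_realC [d d0 ->] dP].
  exists d => // y Dy xy; rewrite -ltcR -rnormE; apply: dP => //=.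
  by rewrite /= rnormE ltcR.
apply/cvgrPdist_lt => _ /gt0_realC [e e0 ->].
have [d d0 dP] := fc x Dx e e0.
apply/nbhs_normP; exists d%:C => /=; first by rewrite ltcR.
by move=> y /=; rewrite rnormE ltcR => xy Dy; rewrite rnormE ltcR dP.
Qed.

Lemma linear_continuousP (A : V -> W) : linear A ->
  continuous A <-> exists2 C : R, 0 <= C & opbound A C.
Proof.
move=> linA.
pose f : {linear V -> W} := HB.pack A (GRing.isLinear.Build _ _ _ _ A linA).
rewrite -[continuous A]/(continuous f) -linear_bounded_continuous.
rewrite linear_boundedP; split=> [/pinfty_ex_gt0 [_ /gt0_realC [C C0 ->] fC]|].
  exists C; first exact: ltW.
  by move=> x; rewrite -lecR -rnormE rmorphM /= -rnormE fC.
move=> [C C0 fC]; near=> r => x.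
rewrite (le_trans (y := C%:C * `|x|)) //; last first.
  by rewrite ler_wpM2r //; near: r; apply: nbhs_pinfty_ge; rewrite ger0_real ?ler0c.
by rewrite !rnormE -rmorphM lecR; exact: fC.
Unshelve. all: by end_near. Qed.

End EpsilonDelta.

Lemma within_realP (R : realType) (D : set R) (f : R -> R) :
  {within D, continuous f} ->
  forall x, D x -> forall e : R, 0 < e -> exists2 d : R, 0 < d &
    forall y, D y -> `|x - y| < d -> `|f x - f y| < e.
Proof.
move=> /subspace_continuousP fc x Dx e e0.
have /cvgrPdist_lt /(_ e e0) /nbhs_normP [d d0 dP] := fc x Dx.
by exists d => // y Dy xy; apply: dP.
Qed.

Section Complete.
Variables (R : realType) (H : completeNormedModType R[i]).

Lemma cauchy_seq_lim (u : nat -> H) :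
  (forall e : R, 0 < e ->
     exists N, forall n m, (N <= n)%N -> (N <= m)%N -> rnorm (u n - u m) <= e) ->
  exists l, forall e : R, 0 < e ->
    exists N, forall n, (N <= n)%N -> rnorm (u n - l) <= e.
Proof.
move=> u_cauchy; have /cvg_ex [l ul] : cvg (u @ \oo).
  apply/cauchy_cvgP/cauchy_ballP => _ /gt0_realC [e e0 ->].
  have [N uN] := u_cauchy (e / 2) (divr_gt0 e0 (ltr0Sn _ 1)).
  exists (u @` [set n | (N <= n)%N], u @` [set n | (N <= n)%N]) => /=.
    by split; exists N => // n Nn; exists n.
  move=> [_ _] /= [[n Nn <-] [m Nm <-]]; rewrite -ball_normE /= rnormE ltcR.
  rewrite (le_lt_trans (uN _ _ Nn Nm)) // ltr_pdivrMr //; lra.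
exists l => e e0.
have /cvgrPdist_le /(_ e%:C) := ul; rewrite ltcR => /(_ e0) [N _ uN].
by exists N => n Nn; rewrite -lecR -rnormE distrC; exact: uN.
Qed.

End Complete.

Section BoundedOperator.
Variables (R : realType) (H : hilbertType R).
Implicit Types A B : H -> H.

Lemma bounded_operatorP A :
  bounded_operator A <-> linear A /\ exists2 C : R, 0 <= C & opbound A C.
Proof.
by split=> -[linA]; [move=> /(linear_continuousP linA) | move=> bA; split=> //;
  apply/(linear_continuousP linA)].
Qed.

Lemma bounded_operatorD A B : bounded_operator A -> bounded_operator B ->
  bounded_operator (fun x => A x + B x).
Proof.
move=> /bounded_operatorP [lA [C C0 bA]] /bounded_operatorP [lB [D D0 bB]].
apply/bounded_operatorP; split=> [a x y|]; first by rewrite lA lB scalerDr addrACA.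
exists (C + D) => [|x]; first exact: addr_ge0.
by rewrite (le_trans (rnormD _ _)) // mulrDl lerD.
Qed.

Lemma bounded_operatorZ (c : R[i]) A : bounded_operator A ->
  bounded_operator (fun x => c *: A x).
Proof.
move=> /bounded_operatorP [lA [C C0 bA]].
apply/bounded_operatorP; split=> [a x y|]; first by rewrite lA scalerDr !scalerA mulrC.
exists (rnorm c * C) => [|x]; first by rewrite mulr_ge0 ?rnorm_ge0.
by rewrite rnormZ -mulrA ler_wpM2l ?rnorm_ge0.
Qed.

Lemma bounded_operator_comp A B : bounded_operator A -> bounded_operator B ->
  bounded_operator (A \o B).
Proof.
move=> [lA cA] [lB cB]; split=> [a x y|x]; first by rewrite /= lB lA.
by apply: continuous_comp; [exact: cB | exact: cA].
Qed.

Lemma bounded_operator_id : bounded_operator (@idfun H).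
Proof. by split=> // x; exact: cvg_id. Qed.

Lemma boundedD A x y : bounded_operator A -> A (x + y) = A x + A y.
Proof. by move=> [lA _]; have := lA 1 x y; rewrite !scale1r. Qed.

Lemma bounded0 A : bounded_operator A -> A 0 = 0.
Proof.
move=> [lA _]; have := lA 1 0 0; rewrite !scale1r addr0 => /eqP.
by rewrite -subr_eq0 opprD addrA subrr sub0r oppr_eq0 => /eqP.
Qed.

Lemma boundedZ A (c : R[i]) x : bounded_operator A -> A (c *: x) = c *: A x.
Proof.
by move=> bA; have [lA _] := bA; rewrite -{1}[c *: x]addr0 lA bounded0 ?addr0.
Qed.

Lemma boundedN A x : bounded_operator A -> A (- x) = - A x.
Proof. by move=> bA; rewrite -scaleN1r boundedZ // scaleN1r. Qed.

Lemma boundedB A x y : bounded_operator A -> A (x - y) = A x - A y.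
Proof. by move=> bA; rewrite boundedD // boundedN. Qed.

End BoundedOperator.

(** * Adjoints and inverses *)

Lemma invS_small (R : realType) (e : R) :
  0 < e -> exists N, forall n, (N <= n)%N -> n.+1%:R^-1 < e.
Proof.
move=> e0; have [N _ NP] := near_infty_natSinv_lt (PosNum e0).
by exists N => n Nn; exact: NP.
Qed.

Section Minimization.
Variables (R : realType) (H : hilbertType R) (S : H -> H) (c : R).
Variables (phi : H -> R[i]) (C : R).
Hypotheses (S_bounded : bounded_operator S) (c_gt0 : 0 < c).
Hypothesis S_below : forall x, c * rnorm x <= rnorm (S x).
Hypothesis phi_linear : forall (a : R[i]) x y, phi (a *: x + y) = a * phi x + phi y.
Hypothesis phi_bounded : forall x, rnorm (phi x) <= C * rnorm x.

(** If [phi z = <S z, S x0>] then [J x = |S (x - x0)|^2 - |S x0|^2], so a representing vector is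
    sought as a minimizer of [J]. The derivative of [J] at [x] in direction [d] is
    [2 Re (w x d)]. *)
Let J x := rnorm (S x) ^+ 2 - 2 * complex.Re (phi x).
Let w x d := (inner (S d) (S x) : R[i]) - phi d.

Let phi0 : phi 0 = 0.
Proof.
have := phi_linear 1 0 0; rewrite scale1r addr0 mul1r => /eqP.
by rewrite -subr_eq0 opprD addrA subrr sub0r oppr_eq0 => /eqP.
Qed.

Let phiD x y : phi (x + y) = phi x + phi y.
Proof. by have := phi_linear 1 x y; rewrite scale1r mul1r. Qed.

Let phiZ a x : phi (a *: x) = a * phi x.
Proof. by have := phi_linear a x 0; rewrite addr0 phi0 addr0. Qed.

Let wZ x a d : w x (a *: d) = a * w x d.
Proof. by rewrite /w boundedZ // phiZ innerZl mulrBr. Qed.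

Let JD x d : J (x + d) = J x + rnorm (S d) ^+ 2 + 2 * complex.Re (w x d).
Proof.
rewrite /J /w boundedD // sqr_rnormD phiD (innerC (S x)).
case: (inner (S d) (S x) : R[i]) (phi x) (phi d) => a1 a2 [b1 b2] [c1 c2] /=.
ring.
Qed.

Let J_lbound x : - (C / c) ^+ 2 <= J x.
Proof.
have phi_le : complex.Re (phi x) <= C / c * rnorm (S x).
  rewrite (le_trans (ler_norm _)) // (le_trans (Re_rnorm _)) //.
  rewrite (le_trans (phi_bounded x)) // -mulrA.
  (* [C] may be negative, but then [phi_bounded] forces [x = 0]. *)
  have [C0|C0] := leP 0 C.
    by rewrite ler_wpM2l // ler_pdivlMl.
  have x0 : rnorm x = 0.
    apply/eqP; rewrite eq_le rnorm_ge0 andbT -(nmulr_rge0 _ C0).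
    exact: le_trans (rnorm_ge0 _) (phi_bounded x).
  have -> : x = 0 by apply/eqP; rewrite -rnorm_eq0 x0.
  by rewrite bounded0 // !rnorm0 !mulr0.
rewrite /J; have := sqr_ge0 (rnorm (S x) - C / c).
by move: (C / c) phi_le => q; nra.
Qed.

Let m := inf (range J).

Let J_has_inf : has_inf (range J).
Proof.
split; first by exists (J 0); exists 0.
by exists (- (C / c) ^+ 2) => _ [x _ <-]; exact: J_lbound.
Qed.

Let m_le x : m <= J x.
Proof. by apply: ge_inf; [case: J_has_inf|exists x]. Qed.

(** This is the parallelogram law; the linear part of [J] cancels. As [J] is at least [m] at the
    midpoint, and [S] is bounded below, a minimizing sequence is Cauchy. *)
Let J_midpoint u v :
  rnorm (S (u - v)) ^+ 2 = 2 * (J u + J v - 2 * J (2^-1%:C *: (u + v))).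
Proof.
set p := _ *: _; set d := 2^-1%:C *: (u - v).
have half x : x = (2^-1%:C : R[i]) *: (x + x).
  have -> : x + x = (2 : R)%:C *: x by rewrite rmorph_nat scaler_nat mulr2n.
  by rewrite scalerA -rmorphM /= mulVf ?scale1r.
have -> : u = p + d by rewrite /p /d -scalerDr addrACA subrr addr0 -half.
have -> : v = p + (-1) *: d.
  rewrite /p /d scaleN1r -scalerBr opprB [v - u]addrC addrACA subrr add0r.
  exact: half.
have -> : p + d - (p + -1 *: d) = d + d.
  by rewrite scaleN1r opprD opprK addrACA subrr add0r.
rewrite !JD (wZ p (-1)) boundedD // (boundedZ (-1) d) // (rnormZ (-1)).
rewrite (rnormN (1 : R[i])) rnorm1 mul1r mulN1r.
have -> : S d + S d = (2 : R)%:C *: S d.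
  by rewrite rmorph_nat scaler_nat mulr2n.
rewrite rnormZ rnorm_real ger0_norm // raddfN /=.
by move: (complex.Re (w p d)) => t; ring.
Qed.

Let J_min : exists x, forall y, J x <= J y.
Proof.
have /choice [u uP] : forall n : nat, exists x, J x < m + n.+1%:R^-1.
  move=> n; have n0 : (0 : R) < n.+1%:R^-1 by rewrite invr_gt0.
  by have [_ [x _ <-] ?] := inf_adherent n0 J_has_inf; exists x.
have [e e0|l lP] := @cauchy_seq_lim R H u.
  (* Two values of [J] within [(c e)^2 / 4] of [m] give [|S (u n - u k)|^2 <= (c e)^2] by
     [J_midpoint]. *)
  have ce0 : 0 < (c * e) ^+ 2 / 4 by rewrite divr_gt0 ?exprn_gt0 ?mulr_gt0.
  have [N NP] := invS_small ce0.
  exists N => n k Nn Nk.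
  rewrite -(ler_pM2l c_gt0) (le_trans (S_below _)) //.
  rewrite -(ler_pXn2r (ltn0Sn 1)) ?nnegrE ?rnorm_ge0 //; last first.
    by rewrite mulr_ge0 // ltW.
  rewrite J_midpoint.
  have lin (E a b i j1 j2 j3 : R) : a < E / 4 -> b < E / 4 -> i <= j3 ->
    j1 < i + a -> j2 < i + b -> 2 * (j1 + j2 - 2 * j3) <= E by lra.
  exact: lin (NP n Nn) (NP k Nk) (m_le _) (uP n) (uP k).
have [D D0 SD] : exists2 D, 0 <= D & opbound S D.
  by have /bounded_operatorP [] := S_bounded.
(* [K |d|] bounds the derivative of [J] at [l] in direction [d], so [J (u n) >= J l - K e], whereas
   [J (u n) < m + e]. This contradicts the choice [J l - m = 2 (K + 1) e]. *)
pose K := 2 * (D * rnorm (S l) + `|C|).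
have K0 : 0 <= K by rewrite mulr_ge0 // addr_ge0 // mulr_ge0 ?rnorm_ge0.
exists l => y; apply: le_trans (m_le y); rewrite leNgt; apply/negP => Jl.
have e0 : 0 < (J l - m) / (2 * (K + 1)) by rewrite divr_gt0 ?subr_gt0 //; lra.
set e := _ / _ in e0.
have [N1 N1P] := invS_small e0; have [N2 N2P] := lP e e0.
pose n := maxn N1 N2; pose d := u n - l.
have d_le : rnorm d <= e by exact/N2P/leq_maxr.
have Ju : J (u n) < m + e.
  by apply: lt_trans (uP n) _; rewrite ltrD2l; apply/N1P/leq_maxl.
have w_ge : - (K * rnorm d) <= 2 * complex.Re (w l d).
  have : `|complex.Re (w l d)| <= D * rnorm d * rnorm (S l) + `|C| * rnorm d.
    apply: le_trans (Re_rnorm _) (le_trans (rnormB _ _) (lerD _ _)).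
      exact: le_trans (Cauchy_Schwarz _ _) (ler_wpM2r (rnorm_ge0 _) (SD d)).
    exact: le_trans (phi_bounded _) (ler_wpM2r (rnorm_ge0 _) (ler_norm _)).
  rewrite ler_norml /K => /andP[]; nra.
have : J (u n) = J l + rnorm (S d) ^+ 2 + 2 * complex.Re (w l d).
  by rewrite -JD /d addrC subrK.
have : J l - m = 2 * (K + 1) * e by rewrite /e mulrCA divff ?mulr1 //; lra.
have := sqr_ge0 (rnorm (S d)); have := rnorm_ge0 d; nra.
Qed.

(** The derivative vanishes at a minimizer. With [S] the identity this is the Riesz representation
    theorem and yields adjoints; with [S] merely bounded below it yields inverses. *)
Lemma quadratic_form_representation :
  exists x, forall z, phi z = inner (S z) (S x).
Proof.
have [x xP] := J_min; exists x => z; apply/eqP.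
rewrite eq_sym -subr_eq0 -[_ - _]/(w x z) -rnorm_eq0 -sqrf_eq0.
rewrite eq_le sqr_ge0 andbT; set q := rnorm (S z).
(* Write [w] for [w x z]. Moving [x] by [- s w^* z] changes [J] by [s |w|^2 (s q^2 - 2)]. As
   [s q^2 = 1 - s], this is [- s (1 + s) |w|^2], which is negative unless [w = 0]. *)
have s0 : 0 < (q ^+ 2 + 1)^-1 by rewrite invr_gt0 ltr_wpDl ?sqr_ge0.
set s := _^-1 in s0.
have := xP (x + (- (s%:C * (w x z)^*)) *: z).
rewrite JD wZ boundedZ // rnormZ rnormN rnormM rnorm_conj rnorm_real gtr0_norm //.
have -> : - (s%:C * (w x z)^*) * w x z = (- (s * rnorm (w x z) ^+ 2))%:C.
  by rewrite mulNr -mulrA [_^* * _]mulrC -sqr_rnorm -rmorphM rmorphN.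
rewrite /= -/q.
have sq : s * (q ^+ 2 + 1) = 1 by rewrite mulVf // gt_eqF // ltr_wpDl ?sqr_ge0.
move: (rnorm _) => a; move: (J x) => j; rewrite !exprMn.
have := sqr_ge0 a; move: (a ^+ 2) (q ^+ 2) sq => A Q sq A0 h.
have : 0 <= A * s * (s * (Q + 1) - s - 2).
  by move: h; nra.
rewrite sq => h2; have : 0 <= A * s * (- (1 + s)) by move: h2; nra.
move=> {}h2; rewrite leNgt; apply/negP => Agt0; have := mulr_gt0 Agt0 s0.
by move: (A * s) h2 => p h2; nra.
Qed.

End Minimization.

Section Adjoint.
Variables (R : realType) (H : hilbertType R).
Implicit Types (A B S T : H -> H) (x y z : H).

Lemma adjoint_exists T : bounded_operator T ->
  exists S, forall x y, inner (T x) y = inner x (S y) :> R[i].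
Proof.
move=> bT; have [C C0 TC] : exists2 C, 0 <= C & opbound T C.
  by have /bounded_operatorP [] := bT.
suff /choice [S SP] : forall y, exists z,
    forall x, inner (T x) y = inner x z :> R[i] by exists S => x y; exact: SP.
move=> y; apply: (@quadratic_form_representation R H idfun 1
  (fun x => inner (T x) y) (C * rnorm y)) => //.
- exact: bounded_operator_id.
- by move=> x; rewrite mul1r.
- by move=> a u v; rewrite boundedD // boundedZ // innerDl innerZl.
- move=> x; apply: le_trans (Cauchy_Schwarz _ _) _.
  by rewrite mulrAC ler_wpM2r ?rnorm_ge0.
Qed.

Lemma adjointP T : bounded_operator T ->
  forall x y, inner (T x) y = inner x (adjoint T y) :> R[i].
Proof. by move=> /adjoint_exists /getPex. Qed.

Lemma adjointPl T : bounded_operator T ->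
  forall x y, inner (adjoint T x) y = inner x (T y) :> R[i].
Proof. by move=> bT x y; rewrite innerC -adjointP // -innerC. Qed.

Lemma adjoint_eq T S : bounded_operator T ->
  (forall x y, inner (T x) y = inner x (S y) :> R[i]) -> adjoint T = S.
Proof.
move=> bT TS; apply/funext => y; apply: inner_eq => z.
by rewrite -adjointP.
Qed.

Lemma opbound_adjoint T (C : R) : bounded_operator T -> 0 <= C ->
  opbound T C -> opbound (adjoint T) C.
Proof.
move=> bT C0 TC y; have [->|] := eqVneq (adjoint T y) 0.
  by rewrite rnorm0 mulr_ge0 ?rnorm_ge0.
rewrite -rnorm_gt0 => n0; rewrite -(ler_pM2l n0) -expr2 rnorm_sqr -adjointP //.
apply: le_trans (ler_norm _) (le_trans (Re_rnorm _) _).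
apply: le_trans (Cauchy_Schwarz _ _) _.
by rewrite mulrA ler_wpM2r ?rnorm_ge0 // mulrC.
Qed.

Lemma bounded_adjoint T : bounded_operator T -> bounded_operator (adjoint T).
Proof.
move=> bT; have [C C0 TC] : exists2 C, 0 <= C & opbound T C.
  by have /bounded_operatorP [] := bT.
apply/bounded_operatorP; split=> [a x y|]; last first.
  by exists C => //; exact: opbound_adjoint.
apply: inner_eq => z; rewrite -adjointP // !innerDr !innerZr.
by rewrite !adjointP.
Qed.

Lemma adjointK T : bounded_operator T -> adjoint (adjoint T) = T.
Proof.
move=> bT; apply: adjoint_eq; first exact: bounded_adjoint.
exact: adjointPl.
Qed.

(** For surjectivity, write [<z, y>] as [<B z, B x>], which equals [<z, A (B x)>]; hence
    [A (B x) = y]. The lower bound on [A] gives injectivity and the bound [c^-1] on the inverse. *)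
Lemma bounded_below_invertible A B (c : R) :
  bounded_operator A -> bounded_operator B ->
  (forall x y, inner (A x) y = inner x (B y) :> R[i]) -> 0 < c ->
  (forall x, c * rnorm x <= rnorm (A x)) ->
  (forall x, c * rnorm x <= rnorm (B x)) ->
  exists G, [/\ bounded_operator G, forall x, G (A x) = x
                                 & forall x, A (G x) = x].
Proof.
move=> bA bB AB c0 Ac Bc.
have A_inj x y : A x = A y -> x = y.
  move=> Axy; apply/eqP; rewrite -subr_eq0 -rnorm_eq0 eq_le rnorm_ge0 andbT.
  by rewrite -(pmulr_rle0 _ c0) (le_trans (Ac _)) // boundedB // Axy subrr rnorm0.
have /choice [G GP] : forall y, exists x, A x = y.
  move=> y; have [||x xP] := quadratic_form_representation
    (phi := fun z => inner z y : R[i]) (C := rnorm y) bB c0 Bc.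
  - by move=> a u v; rewrite innerDl innerZl.
  - by move=> x; rewrite mulrC; exact: Cauchy_Schwarz.
  exists (B x); apply: inner_eq => z.
  by rewrite xP innerC AB -innerC.
exists G; split=> //; last by move=> x; apply: A_inj; rewrite GP.
apply/bounded_operatorP; split=> [a x y|].
  by apply: A_inj; rewrite (boundedD _ _ bA) (boundedZ _ _ bA) !GP.
exists c^-1 => [|x]; first by rewrite invr_ge0 ltW.
by rewrite ler_pdivlMl // -{2}(GP x).
Qed.

End Adjoint.

(** * Spectrum of a positive operator *)

Section SelfAdjoint.
Variables (R : realType) (H : hilbertType R).
Implicit Types (A B S : H -> H) (x y : H) (z w : R[i]).

Definition selfadjoint A :=
  bounded_operator A /\ forall x y, inner (A x) y = inner x (A y) :> R[i].

Definition positive A :=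
  selfadjoint A /\ forall x, 0 <= complex.Re (inner (A x) x : R[i]).

Definition bounded_below A :=
  exists2 c : R, 0 < c & forall x, c * rnorm x <= rnorm (A x).

Lemma bounded_shift A z : bounded_operator A ->
  bounded_operator (fun x => A x - z *: x).
Proof.
move=> bA; have -> : (fun x => A x - z *: x) = (fun x => A x + - z *: x).
  by apply/funext => x; rewrite scaleNr.
by apply: bounded_operatorD => //; exact/bounded_operatorZ/bounded_operator_id.
Qed.

Lemma selfadjoint_inner_real A x : selfadjoint A ->
  (inner (A x) x : R[i]) = (complex.Re (inner (A x) x : R[i]))%:C.
Proof.
move=> [_ sA]; apply/esym/RRe_real; rewrite CrealE.
by apply/eqP; rewrite -innerC sA.
Qed.

Lemma inner_shift A z x : selfadjoint A ->
  inner (A x - z *: x) x =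
    (complex.Re (inner (A x) x : R[i]))%:C - z * (rnorm x ^+ 2)%:C :> R[i].
Proof.
by move=> sA; rewrite innerBl innerZl inner_self {1}selfadjoint_inner_real.
Qed.

(** [A - z] is normal, so its adjoint [A - z^*] inherits its lower bound; this is the second lower
    bound required by [bounded_below_invertible]. *)
Lemma rnorm_shift_conj A z x : selfadjoint A ->
  rnorm (A x - z^* *: x) = rnorm (A x - z *: x).
Proof.
move=> sA; apply/eqP; rewrite -(@eqrXn2 _ 2) ?rnorm_ge0 //.
rewrite !sqr_rnormD !rnormN !rnormZ rnorm_conj !innerNr !innerZr.
rewrite (selfadjoint_inner_real x sA); case: z => a b /=.
by apply/eqP; ring.
Qed.

Lemma not_spectrum_bounded_below A z :
  ~ spectrum A z -> bounded_below (fun x => A x - z *: x).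
Proof.
move=> /contrapT [B [bB BA _]].
have /bounded_operatorP [_ [C C0 BC]] := bB.
exists (C + 1)^-1 => [|x]; first by rewrite invr_gt0; lra.
rewrite ler_pdivrMl; last lra.
rewrite -{1}(BA x) (le_trans (BC _)) // ler_wpM2r ?rnorm_ge0 //; lra.
Qed.

Lemma bounded_below_not_spectrum A z : selfadjoint A ->
  bounded_below (fun x => A x - z *: x) -> ~ spectrum A z.
Proof.
move=> sA [c c0 Ac]; apply; have [bA symA] := sA.
have [||x y|||x|B [bB BA AB]] := @bounded_below_invertible R H
    (fun x => A x - z *: x) (fun x => A x - z^* *: x) c; last by exists B.
- exact: bounded_shift.
- exact: bounded_shift.
- by rewrite innerBl innerBr innerZl innerZr conjCK symA.
- by [].
- by [].
- by rewrite rnorm_shift_conj.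
Qed.

Lemma inner_bounded_below A (c : R) : 0 < c ->
  (forall x, c * rnorm x ^+ 2 <= rnorm (inner (A x) x : R[i])) ->
  bounded_below A.
Proof.
move=> c0 Ac; exists c => // x; have [->|] := eqVneq x 0.
  by rewrite rnorm0 mulr0 rnorm_ge0.
rewrite -rnorm_gt0 => x0; rewrite -(ler_pM2r x0) -mulrA -expr2.
exact: le_trans (Ac x) (Cauchy_Schwarz _ _).
Qed.

(** The form of [A] is real, so [<(A - z) x, x>] has imaginary part [- Im z |x|^2], and [A - z] is
    bounded below when [Im z] is nonzero. *)
Lemma spectrum_selfadjoint_real A z :
  selfadjoint A -> spectrum A z -> z = (complex.Re z)%:C.
Proof.
move=> sA zA; case: z zA => a b zA; apply/eqP; rewrite eq_complex /= eqxx /=.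
apply/negPn/negP => b0; move: zA; apply/bounded_below_not_spectrum => //.
apply: (@inner_bounded_below _ `|b|); first by rewrite normr_gt0.
move=> x; rewrite inner_shift //.
apply: le_trans (Im_rnorm _); rewrite /= !(mulr0, add0r, sub0r, oppr0).
by rewrite normrN normrM (ger0_norm (sqr_ge0 _)).
Qed.

(** The form of [A - t] is at least [- t |x|^2] if [t < 0] and at most [(M - t) |x|^2] if [t > M];
    either way [A - t] is bounded below. *)
Lemma spectrum_positive A (M : R) z : positive A -> opbound A M ->
  spectrum A z -> 0 <= complex.Re z <= M.
Proof.
move=> [sA A0] AM zA.
have zE := spectrum_selfadjoint_real sA zA; rewrite zE in zA.
move: (complex.Re z) zA => t tA {zE z}.
have innerE x : rnorm (inner (A x - t%:C *: x) x : R[i]) =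
    `|complex.Re (inner (A x) x : R[i]) - t * rnorm x ^+ 2|.
  by rewrite inner_shift // -rmorphM -rmorphB rnorm_real.
apply/andP; split; rewrite leNgt; apply/negP => ht; move: tA;
  apply/bounded_below_not_spectrum => //.
  apply: (@inner_bounded_below _ (- t)); first by rewrite oppr_gt0.
  move=> x; rewrite innerE (le_trans _ (ler_norm _)) //.
  by rewrite mulNr lerDr A0.
apply: (@inner_bounded_below _ (t - M)); first by rewrite subr_gt0.
move=> x; rewrite innerE distrC (le_trans _ (ler_norm _)) //.
have : complex.Re (inner (A x) x : R[i]) <= M * rnorm x ^+ 2.
  apply: le_trans (ler_norm _) (le_trans (Re_rnorm _) _).
  apply: le_trans (Cauchy_Schwarz _ _) _.
  by rewrite expr2 mulrA ler_wpM2r ?rnorm_ge0.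
by rewrite mulrBl; lra.
Qed.

(** A lower bound [c] for [A - z] leaves the lower bound [c / 2] for [A - w] whenever
    [|w - z| < c / 2]. *)
Lemma spectrum_closed A z : selfadjoint A ->
  (forall e : R, 0 < e -> exists2 w, spectrum A w & rnorm (w - z) < e) ->
  spectrum A z.
Proof.
move=> sA zA; apply: contrapT => /not_spectrum_bounded_below [c c0 Ac].
have c20 : 0 < c / 2 by rewrite divr_gt0.
have [w wA wz] := zA _ c20.
move: wA; apply/bounded_below_not_spectrum => //; exists (c / 2) => // x.
have : rnorm (A x - z *: x) <= rnorm (A x - w *: x) + rnorm (w *: x - z *: x).
  by rewrite -[A x - z *: x](subrKA (w *: x)) rnormD.
have := Ac x; rewrite -scalerBl rnormZ.
have : rnorm (w - z) * rnorm x <= c / 2 * rnorm x.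
  by rewrite ler_wpM2r ?rnorm_ge0 // ltW.
by move: (rnorm x) => X; lra.
Qed.

(* Expand [<S(x - t Sx), x - t Sx> >= 0] at [t = 1 / (||S|| + 1)]. *)
Lemma positive_bounded_below S : positive S -> bounded_below S ->
  exists2 e : R, 0 < e &
    forall x, e * rnorm x ^+ 2 <= complex.Re (inner (S x) x : R[i]).
Proof.
move=> [[bS symS] S0] [c c0 Sc].
have /bounded_operatorP [_ [C C0 SC]] := bS.
have C1 : 0 < C + 1 by rewrite ltr_wpDl.
pose t := (C + 1)^-1; have t0 : 0 < t by rewrite invr_gt0.
have tC : t * (C + 1) = 1 by rewrite mulVf // gt_eqF.
exists (t * c ^+ 2) => [|x]; first by rewrite mulr_gt0 ?exprn_gt0.
have := S0 (x - t%:C *: S x).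
rewrite boundedB // boundedZ // !(innerBl, innerBr, innerZl, innerZr) conj_real.
rewrite (symS (S x) x) !inner_self.
have : complex.Re (inner (S (S x)) (S x) : R[i]) <= C * rnorm (S x) ^+ 2.
  apply: le_trans (ler_norm _) (le_trans (Re_rnorm _) _).
  apply: le_trans (Cauchy_Schwarz _ _) _.
  by rewrite expr2 mulrA ler_wpM2r ?rnorm_ge0.
have : (c * rnorm x) ^+ 2 <= rnorm (S x) ^+ 2.
  by rewrite ler_pXn2r // nnegrE ?rnorm_ge0 // mulr_ge0 ?rnorm_ge0 // ltW.
have := sqr_ge0 (rnorm (S x)); rewrite exprMn.
case: (inner (S x) x : R[i]) (inner (S (S x)) (S x) : R[i]) => a a' [b b'] /=.
move: (rnorm x ^+ 2) (rnorm (S x) ^+ 2) (c ^+ 2) => X Y D Y0 h1 h2.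
rewrite !(mul0r, subr0, mulr0) => h3.
have h4 : t * t * b <= t * Y - t * t * Y.
  have := ler_wpM2l (ltW (mulr_gt0 t0 t0)) h2.
  have -> : t * t * (C * Y) = t * (t * (C + 1)) * Y - t * t * Y by ring.
  by rewrite tC mulr1.
have h5 := ler_wpM2l (ltW t0) h1.
have h6 : 0 <= t * t * Y by rewrite !mulr_ge0 ?(ltW t0).
rewrite -mulrA; lra.
Qed.

(** Let [m] be the infimum of the form on the unit sphere. Were [m] outside the spectrum, [S - m]
    would be positive and bounded below, so its form would be at least some [e > 0] on the sphere,
    contradicting the choice of [m]. The vector [x0] keeps the sphere nonempty. *)
Lemma selfadjoint_spectrum_inf S (x0 : H) : selfadjoint S -> x0 != 0 ->
  exists2 m : R, spectrum S m%:C &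
    forall x, m * rnorm x ^+ 2 <= complex.Re (inner (S x) x : R[i]).
Proof.
move=> sS x0_neq0; have [bS symS] := sS.
have /bounded_operatorP [_ [C C0 SC]] := bS.
pose F x := complex.Re (inner (S x) x : R[i]).
pose E := [set F x | x in [set x : H | rnorm x = 1]].
have E_inf : has_inf E.
  split; first by exists (F ((rnorm x0)^-1%:C *: x0)), ((rnorm x0)^-1%:C *: x0);
    first exact: rnorm_unit.
  exists (- C) => _ [x /= x1 <-]; rewrite lerNl (le_trans (ler_norm _)) //.
  rewrite normrN (le_trans (Re_rnorm _)) // (le_trans (Cauchy_Schwarz _ _)) //.
  by have := SC x; rewrite x1 !mulr1.
have F_ge x : inf E * rnorm x ^+ 2 <= F x.
  have [->|x_neq0] := eqVneq x 0.
    by rewrite rnorm0 expr0n mulr0 /F inner0r.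
  have n0 : 0 < rnorm x by rewrite rnorm_gt0.
  have : inf E <= F ((rnorm x)^-1%:C *: x).
    apply: ge_inf; first by case: E_inf.
    by exists ((rnorm x)^-1%:C *: x) => //; exact: rnorm_unit.
  rewrite /F boundedZ // innerZl innerZr conj_real mulrA -rmorphM.
  case: (inner (S x) x : R[i]) => a b /=; rewrite !mul0r subr0 -expr2.
  by rewrite exprVn ler_pdivlMl ?exprn_gt0 // mulrC.
exists (inf E) => //; apply: contrapT => /not_spectrum_bounded_below Sb.
have innerE x : complex.Re (inner (S x - (inf E)%:C *: x) x : R[i]) =
    F x - inf E * rnorm x ^+ 2.
  by rewrite inner_shift // -rmorphM -rmorphB.
have [||e e0 eP] := @positive_bounded_below (fun x => S x - (inf E)%:C *: x).
- split; last by move=> x; rewrite innerE subr_ge0.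
  split; first exact: bounded_shift.
  by move=> x y; rewrite innerBl innerBr innerZl innerZr conj_real symS.
- by [].
have [_ [x /= x1 <-]] := inf_adherent e0 E_inf.
have := eP x; rewrite innerE x1 expr1n; lra.
Qed.

End SelfAdjoint.

(** * Polynomial calculus *)

Section PolynomialCalculus.
Variables (R : realType) (H : hilbertType R).
Implicit Types (A B S : H -> H) (x y : H) (p q : {poly R[i]}).

Definition polyop A p x : H := \sum_(i < size p) p`_i *: iter i A x.

Lemma polyop_widen A p n x : (size p <= n)%N ->
  polyop A p x = \sum_(i < n) p`_i *: iter i A x.
Proof.
move=> pn; rewrite /polyop (big_ord_widen _ (fun i => p`_i *: iter i A x) pn).
rewrite big_mkcond /=; apply: eq_bigr => i _.
by case: ltnP => // pi; rewrite nth_default // scale0r.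
Qed.

Lemma polyopD A p q x : polyop A (p + q) x = polyop A p x + polyop A q x.
Proof.
pose n := maxn (size p) (size q).
rewrite (polyop_widen A x (size_polyD p q)) -/n.
rewrite (polyop_widen A x (leq_maxl _ _ : (size p <= n)%N)).
rewrite (polyop_widen A x (leq_maxr _ _ : (size q <= n)%N)) -big_split.
by apply: eq_bigr => i _; rewrite coefD scalerDl.
Qed.

Lemma polyopZ A (a : R[i]) p x : polyop A (a *: p) x = a *: polyop A p x.
Proof.
rewrite (polyop_widen A x (size_scale_leq a p)) /polyop scaler_sumr.
by apply: eq_bigr => i _; rewrite coefZ scalerA.
Qed.

Lemma polyopC A (a : R[i]) x : polyop A a%:P x = a *: x.
Proof. by rewrite (polyop_widen A x (size_polyC_leq1 a)) big_ord1 coefC. Qed.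

Lemma polyopMX A p x : polyop A (p * 'X) x = polyop A p (A x).
Proof.
have h : (size (p * 'X)%R <= (size p).+1)%N.
  by rewrite (leq_trans (size_polyMleq _ _)) // size_polyX addn2.
rewrite (polyop_widen A x h) big_ord_recl coefMX eqxx scale0r add0r.
by apply: eq_bigr => i _; rewrite coefMX /= -iterSr.
Qed.

Lemma polyopX A x : polyop A 'X x = A x.
Proof. by rewrite -['X]mul1r polyopMX -polyC1 polyopC scale1r. Qed.

Lemma polyopN A p x : polyop A (- p) x = - polyop A p x.
Proof. by rewrite -scaleN1r polyopZ scaleN1r. Qed.

Lemma polyopB A p q x : polyop A (p - q) x = polyop A p x - polyop A q x.
Proof. by rewrite polyopD polyopN. Qed.

Lemma bounded_polyop A p : bounded_operator A -> bounded_operator (polyop A p).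
Proof.
move=> bA; elim/poly_ind: p => [|p c IH].
  have -> : polyop A 0 = (fun x => (0 : R[i]) *: idfun x).
    by apply/funext => x; rewrite -(polyopC A).
  exact/bounded_operatorZ/bounded_operator_id.
have -> : polyop A (p * 'X + c%:P) = (fun x => (polyop A p \o A) x + c *: idfun x).
  by apply/funext => x; rewrite polyopD polyopMX polyopC.
apply: bounded_operatorD; first exact: bounded_operator_comp.
exact/bounded_operatorZ/bounded_operator_id.
Qed.

(** Two operators are allowed with a view to [T^* T] and [T T^*], and to |T| and |T^*|. The case of
    three equal operators is the commutation behind [polyopM]. *)
Lemma polyop_intertwine T A B p x : bounded_operator T ->
  (forall y, T (A y) = B (T y)) -> T (polyop A p x) = polyop B p (T x).
Proof.
move=> bT TAB; elim/poly_ind: p x => [|p c IH] x.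
  by rewrite -polyC0 !polyopC !scale0r bounded0.
by rewrite !polyopD !polyopMX !polyopC boundedD // boundedZ // IH TAB.
Qed.

Lemma polyopM A p q x : bounded_operator A ->
  polyop A (p * q) x = polyop A p (polyop A q x).
Proof.
move=> bA; elim/poly_ind: p x => [|p c IH] x.
  by rewrite mul0r -polyC0 !polyopC !scale0r.
rewrite mulrDl -mulrA [_ * q]mulrC mulrA mul_polyC !polyopD polyopZ !polyopMX.
by rewrite polyopC IH (@polyop_intertwine A A A).
Qed.

Lemma polyop_adjoint A p x y : selfadjoint A ->
  inner (polyop A p x) y = inner x (polyop A (map_poly Num.conj p) y) :> R[i].
Proof.
move=> [bA sA].
have iterA i u v : inner (iter i A u) v = inner u (iter i A v) :> R[i].
  by elim: i u v => [//|i IH] u v; rewrite iterS sA IH -iterSr.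
rewrite /polyop size_map_poly.
elim/big_rec2: _ => [|i u v _ IH]; first by rewrite inner0l inner0r.
by rewrite innerDl innerDr innerZl innerZr IH coef_map /= conjCK iterA.
Qed.

Lemma polyop_prod_bounded_below A (s : seq R[i]) : selfadjoint A ->
  (forall z, z \in s -> ~ spectrum A z) ->
  bounded_below (polyop A (\prod_(z <- s) ('X - z%:P))).
Proof.
move=> [bA _]; elim: s => [|z s IH] sA.
  exists 1 => // x; rewrite big_nil -polyC1 polyopC scale1r mul1r.
  exact: lexx.
have [|c c0 Pc] := IH; first by move=> w ws; apply: sA; rewrite inE ws orbT.
have [|d d0 Ac] := @not_spectrum_bounded_below R H A z.
  by apply: sA; rewrite mem_head.
exists (d * c) => [|x]; first exact: mulr_gt0.
rewrite big_cons polyopM // polyopB polyopX polyopC.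
apply: le_trans (Ac _); rewrite -mulrA ler_wpM2l ?Pc //; exact: ltW.
Qed.

(* If [q >= 0] on the spectrum but [q(A)] is not positive, then the infimum
   [m < 0] of its numerical range is a spectral value of [q(A)]; factoring
   [q - m] over R[i] shows that some root of [q - m] is in the spectrum of A. *)
Lemma polyop_contractive A p (c : R) : selfadjoint A ->
  (forall z, spectrum A z -> rnorm p.[z] <= c) -> opbound (polyop A p) c.
Proof.
move=> sA pc x0; have [bA symA] := sA.
have [->|x0_neq0] := eqVneq x0 0.
  by rewrite bounded0 ?rnorm0 ?mulr0 //; exact: bounded_polyop.
(* This spectral value yields [0 <= c], and later shows that [q - m] is not the zero polynomial. *)
have [m0 m0A _] := selfadjoint_spectrum_inf sA x0_neq0.
have c0 : 0 <= c by apply: le_trans (rnorm_ge0 _) (pc _ m0A).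
rewrite leNgt; apply/negP => px0.
(* On the real spectrum [q] takes the values [c^2 - |p|^2 >= 0], while
   [<q(A) x, x> = c^2 |x|^2 - |p(A) x|^2] is negative at [x0]. *)
pose q := (c ^+ 2)%:C%:P - map_poly Num.conj p * p.
have qE x : polyop A q x = (c ^+ 2)%:C *: x -
    polyop A (map_poly Num.conj p) (polyop A p x).
  by rewrite polyopB polyopC polyopM.
have sq : selfadjoint (polyop A q).
  split=> [|x y]; first exact: bounded_polyop.
  rewrite !qE innerBl innerBr innerZl innerZr conj_real.
  rewrite -(polyop_adjoint p x) // (innerC (polyop A (map_poly _ _) _)).
  by rewrite -polyop_adjoint // -innerC.
have qA x : complex.Re (inner (polyop A q x) x : R[i]) =
    c ^+ 2 * rnorm x ^+ 2 - rnorm (polyop A p x) ^+ 2.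
  rewrite qE innerBl innerZl (innerC (polyop A _ _)) -polyop_adjoint //.
  by rewrite !inner_self conj_real -rmorphM -rmorphB.
have [m mq m_le] := selfadjoint_spectrum_inf sq x0_neq0.
have m_lt0 : m < 0.
  have := m_le x0; rewrite qA -exprMn.
  have : (c * rnorm x0) ^+ 2 < rnorm (polyop A p x0) ^+ 2.
    by rewrite ltr_pXn2r // nnegrE ?rnorm_ge0 // mulr_ge0 ?rnorm_ge0.
  move: (sqr_ge0 (rnorm x0)) => n0 h1 h2.
  have h3 : m * rnorm x0 ^+ 2 < 0 by lra.
  by rewrite ltNge; apply/negP => m_ge0; have := mulr_ge0 m_ge0 n0; lra.
have qz z : spectrum A z -> (q - m%:C%:P).[z] != 0.
  move=> zA; have zE : z = z^*.
    by rewrite {2}(spectrum_selfadjoint_real sA zA) conj_real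
      -(spectrum_selfadjoint_real sA zA).
  rewrite !hornerE {1}zE horner_map /= [_^* * _]mulrC -sqr_rnorm.
  rewrite -!rmorphB /= eq_complex /= eqxx andbT gt_eqF //.
  have : rnorm p.[z] ^+ 2 <= c ^+ 2.
    by rewrite ler_pXn2r ?nnegrE ?rnorm_ge0 //; exact: pc.
  by lra.
have [r rE] := closed_field_poly_normal (q - m%:C%:P).
have lead_neq0 : lead_coef (q - m%:C%:P) != 0.
  rewrite lead_coef_eq0; apply/eqP => q0.
  by have := qz _ m0A; rewrite q0 horner0 eqxx.
have [|d d0 rd] := @polyop_prod_bounded_below A r sA.
  move=> z zr zA; have := qz _ zA.
  have /rootP z_root : root (\prod_(w <- r) ('X - w%:P)) z.
    by rewrite root_prod_XsubC.
  by rewrite rE hornerZ z_root mulr0 eqxx.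
move: mq; apply/bounded_below_not_spectrum => //.
exists (rnorm (lead_coef (q - m%:C%:P)) * d) => [|x].
  by rewrite mulr_gt0 // rnorm_gt0.
rewrite -(polyopC A) -polyopB {2}rE polyopZ rnormZ -mulrA.
by rewrite ler_wpM2l ?rnorm_ge0 // rd.
Qed.

End PolynomialCalculus.

(** * Weierstrass approximation *)

Section Weierstrass.
Variable R : realType.
Implicit Types (K : set R) (h : R -> R[i]) (u : {poly R[i]}) (phi : nat -> R[i]).

(* The Bernstein polynomial [\sum_(k <= n) 'C(n, k) u ^ k (1 - u) ^ (n - k) phi k]
   by its recurrence in n, which replaces all binomial sums by inductions. *)
Fixpoint bernstein u n phi : {poly R[i]} :=
  if n is n'.+1 then
    u * bernstein u n' (phi \o S) + (1 - u) * bernstein u n' phi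
  else (phi 0%N)%:P.

(* [n s (1 - s) + (n s - c) ^ 2] is the second moment about c of the binomial
   law with parameters n and s. *)
Lemma bernstein_approx u n phi (v z : R[i]) (a b c s : R) :
  u.[z] = s%:C -> 0 <= s <= 1 ->
  (forall k, rnorm (phi k - v) <= a + b * (k%:R - c) ^+ 2) ->
  rnorm ((bernstein u n phi).[z] - v) <=
    a + b * (n%:R * (s * (1 - s)) + (n%:R * s - c) ^+ 2).
Proof.
move=> uz /andP[s0 s1]; elim: n phi c => [|n IH] phi c phi_le.
  by rewrite /= hornerC !mul0r add0r; exact: phi_le.
rewrite /= !hornerE uz -(rmorph1 (real_complex R)) -rmorphB /=.
set p := (bernstein u n _).[z]; set q := (bernstein u n phi).[z].
have -> : s%:C * p + (1 - s)%:C * q - v =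
    s%:C * (p - v) + (1 - s)%:C * (q - v) by rewrite rmorphB rmorph1; ring.
apply: le_trans (rnormD _ _) _; rewrite !rnormM !rnorm_real.
rewrite !ger0_norm ?subr_ge0 //.
have p_le : rnorm (p - v) <=
    a + b * (n%:R * (s * (1 - s)) + (n%:R * s - (c - 1)) ^+ 2).
  apply: IH => k; apply: le_trans (phi_le k.+1) _; rewrite -natr1.
  by have -> : k%:R - (c - 1) = k%:R + 1 - c by ring.
have q_le := IH phi c phi_le.
apply: le_trans (lerD (ler_wpM2l s0 p_le) (ler_wpM2l (_ : 0 <= 1 - s) q_le)) _.
  by rewrite subr_ge0.
rewrite -natr1 le_eqVlt; apply/orP; left; apply/eqP; ring.
Qed.

(** The modulus is quadratic because [bernstein_approx] turns such a bound into a second moment,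
    which is explicit. *)
Lemma compact_modulus K h (e : R) : compact K ->
  (forall x, K x -> forall d : R, 0 < d -> exists2 r : R, 0 < r &
    forall y, K y -> `|x - y| < r -> rnorm (h x - h y) < d) ->
  0 < e ->
  exists2 C : R, 0 <= C & forall x y, K x -> K y ->
    rnorm (h x - h y) <= e + C * (x - y) ^+ 2.
Proof.
move=> cK hc e0; have e20 : 0 < e / 2 by rewrite divr_gt0.
(* The same [n] controls the size of [h] and the radius of uniformity, so one covering argument
   gives both. *)
pose P (n : nat) x := K x -> rnorm (h x) <= n%:R /\
  forall y, K y -> `|x - y| < n.+1%:R^-1 -> rnorm (h x - h y) <= e.
have [|N _ NP] := (compact_near_coveringP K).1 cK nat \oo P.
  move=> x Kx; have [r r0 rP] := hc x Kx _ e20.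
  have r20 : 0 < r / 2 by rewrite divr_gt0.
  have [N NP] := invS_small r20.
  have [N' N'P] : exists N', forall n, (N' <= n)%N -> rnorm (h x) + e <= n%:R.
    have := archi_boundP (addr_ge0 (rnorm_ge0 (h x)) (ltW e0)).
    set N' := Num.bound _ => N'P; exists N' => n N'n.
    by apply: le_trans (ltW N'P) _; rewrite ler_nat.
  exists (ball x (r / 2), [set n | (maxn N N' <= n)%N]).
    split; first exact: nbhsx_ballx.
    by exists (maxn N N').
  move=> [y n] /= [xy]; rewrite geq_max => /andP[Nn N'n] Ky.
  have xyr : `|x - y| < r / 2 by exact: xy.
  have hxy : rnorm (h x - h y) < e / 2 by apply: rP => //; lra.
  split=> [|z Kz yz].
    have := rnormB (h x) (h x - h y); rewrite opprB addrC subrK => h1.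
    by have := N'P n N'n; lra.
  have hxz : rnorm (h x - h z) < e / 2.
    apply: rP => //; have := ler_distD y x z; have := lt_trans yz (NP n Nn); lra.
  have := rdistD (h x) (h y) (h z); rewrite (rdistC (h y) (h x)); lra.
have {}NP x : K x -> rnorm (h x) <= N%:R /\
    forall y, K y -> `|x - y| < N.+1%:R^-1 -> rnorm (h x - h y) <= e.
  by move=> Kx; exact: (NP N (leqnn N) x Kx Kx).
(* If [|x - y| >= 1 / (N + 1)], then [(N + 1)^2 (x - y)^2 >= 1], which absorbs the crude bound
   [2 N]. *)
exists (2 * N%:R * N.+1%:R ^+ 2) => [|x y Kx Ky].
  by rewrite !mulr_ge0 // sqr_ge0.
have N0 : (0 : R) < N.+1%:R by [].
have [xy|xy] := ltP `|x - y| N.+1%:R^-1.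
  apply: le_trans ((NP x Kx).2 y Ky xy) _.
  by rewrite lerDl mulr_ge0 ?sqr_ge0 // !mulr_ge0 // sqr_ge0.
have h1 : 1 <= N.+1%:R ^+ 2 * (x - y) ^+ 2.
  have h2 : 1 <= N.+1%:R * `|x - y| by rewrite -ler_pdivrMl // mulr1.
  have := exprn_ege1 2 h2; rewrite exprMn real_normK //; exact: num_real.
have := (NP x Kx).1; have := (NP y Ky).1; have := rnormB (h x) (h y).
have : 2 * N%:R * 1 <= 2 * N%:R * (N.+1%:R ^+ 2 * (x - y) ^+ 2) :> R.
  by rewrite ler_wpM2l ?mulr_ge0.
rewrite mulrA; lra.
Qed.

Lemma Weierstrass_compact K (M : R) h (e : R) : compact K ->
  (forall t, K t -> 0 <= t <= M) ->
  (forall x, K x -> forall d : R, 0 < d -> exists2 r : R, 0 < r &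
    forall y, K y -> `|x - y| < r -> rnorm (h x - h y) < d) ->
  0 < e ->
  exists p : {poly R[i]}, forall t, K t -> rnorm (p.[t%:C] - h t) <= e.
Proof.
move=> cK KM hc e0.
have [K0|nK0] := pselect (K !=set0); last first.
  by exists 0 => t Kt; case: nK0; exists t.
have e20 : 0 < e / 2 by rewrite divr_gt0.
have [C C0 hC] := compact_modulus cK hc e20.
(* Nothing is known of [h] off [K], so each Bernstein node [tau] is replaced by a nearest point of
   [K]. For [t] in [K] this at most doubles the distance, [|pi tau - t| <= 2 |tau - t|], whence the
   factor 4 below. *)
have /choice [pi piP] : forall t : R, exists y, K y /\
    forall x, K x -> `|t - y| <= `|t - x|.
  move=> t; have [|y yK yP] := @compact_EVT_min R R (fun y => `|t - y|) K K0 cK.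
    apply: continuous_subspaceT => y; apply: cvg_norm.
    by apply: cvgB; [exact: cvg_cst | exact: cvg_id].
  by exists y; rewrite inE in yK; split=> // x Kx; apply: yP; rewrite inE.
have [t0 Kt0] := K0.
have M0 : 0 <= M by have /andP[h1 h2] := KM _ Kt0; exact: le_trans h2.
(* [M] may be 0, and the interval is rescaled by division. *)
pose M' := M + 1; have M'0 : 0 < M' by rewrite ltr_wpDl.
have D_ge0 : 0 <= 4 * C * M' ^+ 2 by rewrite mulr_ge0 ?sqr_ge0 // mulr_ge0.
have e'0 : 0 < e / 2 / (4 * C * M' ^+ 2 + 1) by rewrite divr_gt0 // ltr_wpDl.
have [N NP] := invS_small e'0.
have n0 : (0 : R) < N.+1%:R by [].
pose u : {poly R[i]} := (M'^-1)%:C *: 'X.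
pose phi k := h (pi (k%:R * M' / N.+1%:R)).
exists (bernstein u N.+1 phi) => t Kt.
have /andP[t_ge0 tM] := KM t Kt.
have s01 : 0 <= t / M' <= 1.
  rewrite divr_ge0 ?(ltW M'0) //= ler_pdivrMr // mul1r /M'; lra.
have uz : u.[t%:C] = (t / M')%:C by rewrite hornerZ hornerX -rmorphM mulrC.
(* With [n = N + 1] and [s = t / M'], centring at [n s] leaves only the variance [n s (1 - s)], so
   the quadratic term costs at most [4 C M'^2 / n <= e / 2]. *)
apply: le_trans (bernstein_approx (b := 4 * C * (M' / N.+1%:R) ^+ 2)
  (a := e / 2) (c := N.+1%:R * (t / M')) N.+1 uz s01 _) _ => [k|].
  rewrite /phi; set tau := _ / _ in piP *.
  have [Kp pmin] := piP tau.
  apply: le_trans (hC _ _ Kp Kt) _; rewrite lerD2l.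
  have -> : 4 * C * (M' / N.+1%:R) ^+ 2 * (k%:R - N.+1%:R * (t / M')) ^+ 2 =
      C * (2 * (tau - t)) ^+ 2 by rewrite /tau; field; rewrite !gt_eqF.
  rewrite ler_wpM2l // -(real_normK (num_real (pi tau - t))).
  rewrite -(real_normK (num_real (2 * _))) ler_pXn2r ?nnegrE //.
  have := pmin t Kt; have := ler_distD tau (pi tau) t; rewrite (distrC (pi tau) tau).
  by rewrite normrM (ger0_norm (ler0n _ 2)); lra.
rewrite subrr expr0n addr0.
have : N.+1%:R^-1 * (4 * C * M' ^+ 2 + 1) <= e / 2.
  by rewrite -ler_pdivlMr ?ltr_wpDl //; exact/ltW/NP.
have -> : 4 * C * (M' / N.+1%:R) ^+ 2 * (N.+1%:R * (t / M' * (1 - t / M'))) =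
    4 * C * M' ^+ 2 * N.+1%:R^-1 * (t / M' * (1 - t / M')).
  by field; rewrite !gt_eqF.
have : t / M' * (1 - t / M') <= 1.
  by move: (t / M') s01 => s /andP[]; nra.
have : (0 : R) < N.+1%:R^-1 by rewrite invr_gt0.
move: (t / M' * _) N.+1%:R^-1 (4 * C * M' ^+ 2) D_ge0 => s r D D0 r0 s1 h1.
have := ler_wpM2l (mulr_ge0 D0 (ltW r0)) s1; lra.
Qed.

End Weierstrass.

(** * Continuous functional calculus *)

(** One [d] serves for both [d * K <= e] and [d <= e], even when [K = 0]. *)
Lemma exists_scale (R : realType) (K e : R) : 0 <= K -> 0 < e ->
  exists2 d : R, 0 < d & d * K + d = e.
Proof.
move=> K0 e0; have K1 : 0 < K + 1 by rewrite ltr_wpDl.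
exists (e / (K + 1)); first exact: divr_gt0.
by rewrite -[X in _ + X]mulr1 -mulrDr divfK // gt_eqF.
Qed.

Section CalculusExistence.
Variables (R : realType) (H : hilbertType R) (A : H -> H).
Hypothesis A_positive : positive A.
Implicit Types (B : H -> H) (h k : R[i] -> R[i]) (p q : {poly R[i]}) (z : R[i]).

Let A_selfadjoint : selfadjoint A. Proof. by case: A_positive. Qed.
Let A_bounded : bounded_operator A. Proof. by case: A_selfadjoint. Qed.

Lemma spectrum_positive_bound :
  exists2 M : R, 0 <= M & forall t : R, spectrum A t%:C -> 0 <= t <= M.
Proof.
have /bounded_operatorP [_ [M M0 AM]] := A_bounded.
by exists M => // t /(spectrum_positive A_positive AM).
Qed.

Lemma compact_spectrum : compact [set t : R | spectrum A t%:C].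
Proof.
have [M _ AM] := spectrum_positive_bound.
apply: (@subclosed_compact _ _ `[0, M]%classic).
- move=> t tA; apply: spectrum_closed => // e e0.
  have [s [/= sA st]] := tA _ (nbhsx_ballx t e e0).
  exists s%:C => //; rewrite -rmorphB rnorm_real distrC; exact: st.
- exact: segment_compact.
- by move=> t tA; rewrite /= in_itv /=; exact: AM.
Qed.

Lemma spectrum_real_continuous h : spectrum_continuous A h ->
  forall x : R, spectrum A x%:C -> forall d : R, 0 < d ->
  exists2 r : R, 0 < r & forall y, spectrum A y%:C -> `|x - y| < r ->
    rnorm (h x%:C - h y%:C) < d.
Proof.
move=> /within_continuousP hc x xA d d0; have [r r0 rP] := hc _ xA d d0.
exists r => // y yA xy; apply: rP => //.
by rewrite -[_ - _]/(x%:C - y%:C : R[i]) -rmorphB; rewrite /= -rnorm_real in xy.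
Qed.

Lemma spectrum_approx h (e : R) : spectrum_continuous A h -> 0 < e ->
  exists p, forall z, spectrum A z -> rnorm (p.[z] - h z) <= e.
Proof.
move=> hc e0; have [M _ AM] := spectrum_positive_bound.
have [p pP] := Weierstrass_compact compact_spectrum AM
  (spectrum_real_continuous hc) e0.
exists p => z zA; have zE := spectrum_selfadjoint_real A_selfadjoint zA.
by rewrite zE; apply: pP; rewrite /= -zE.
Qed.

Lemma spectrum_continuous_bounded h : spectrum_continuous A h ->
  exists2 c : R, 0 <= c & forall z, spectrum A z -> rnorm (h z) <= c.
Proof.
move=> hc; have [M M0 AM] := spectrum_positive_bound.
have [C C0 hC] := compact_modulus compact_spectrum
  (spectrum_real_continuous hc) ltr01.
have [[t0 t0A]|nA] := pselect (exists t : R, spectrum A t%:C); last first.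
  exists 0 => // z zA; case: nA; exists (complex.Re z).
  by rewrite -(spectrum_selfadjoint_real A_selfadjoint zA).
exists (rnorm (h t0%:C) + (1 + C * M ^+ 2)) => [|z zA].
  by rewrite !addr_ge0 ?rnorm_ge0 // mulr_ge0 // sqr_ge0.
have zE := spectrum_selfadjoint_real A_selfadjoint zA.
rewrite zE in zA *; move: (complex.Re z) zA => t tA.
have := hC t t0 tA t0A; have := rnorm_lerBr (h t%:C) (h t0%:C).
have : C * (t - t0) ^+ 2 <= C * M ^+ 2.
  rewrite ler_wpM2l //; have := AM _ tA; have := AM _ t0A; nra.
lra.
Qed.

(** A single polynomial is close to [h] on the spectrum and to [B] in norm, so algebraic operations
    on [h] and on [B] can be performed on the same polynomials. *)
Definition approximates h B := bounded_operator B /\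
  forall e : R, 0 < e -> exists2 p,
    forall z, spectrum A z -> rnorm (p.[z] - h z) <= e &
    opbound (fun x => polyop A p x - B x) e.

Lemma approximates_unique h k B B' : approximates h B -> approximates k B' ->
  (forall z, spectrum A z -> h z = k z) -> B = B'.
Proof.
move=> [_ hB] [_ kB'] hk; apply/funext => x; apply/eqP.
rewrite -subr_eq0 -rnorm_eq0 eq_le rnorm_ge0 andbT.
apply/ler_addgt0Pr => e e0; rewrite add0r.
(* The factor 4 counts [d] for each of [B] and [B'], and [2 d] for [p - q], which is at most [2 d]
   on the spectrum. *)
have [d d0 dE] : exists2 d, 0 < d & d * (4 * rnorm x) + d = e.
  by apply: exists_scale; rewrite ?mulr_ge0 ?rnorm_ge0.
have [p ph pB] := hB d d0; have [q qk qB] := kB' d d0.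
have pq : opbound (polyop A (p - q)) (2 * d).
  apply: polyop_contractive => // z zA; rewrite hornerD hornerN.
  have := rdistD (h z) p.[z] q.[z]; have := ph z zA.
  rewrite (rdistC (h z)) (hk z zA); have := qk z zA; lra.
have := pB x; have := qB x; have := pq x; rewrite polyopB.
have := rdistD (polyop A p x) (B x) (B' x).
have := rdistD (polyop A q x) (polyop A p x) (B' x).
by rewrite (rdistC (B x) (polyop A p x)); lra.
Qed.

Lemma approximates_exists h : spectrum_continuous A h -> exists B, approximates h B.
Proof.
move=> hc; have [r [r0 r_mono r_small]] : exists r : nat -> R,
    [/\ forall n, 0 < r n, forall n m, (n <= m)%N -> r m <= r n &
        forall e, 0 < e -> exists N, forall n, (N <= n)%N -> r n < e].
  exists (fun n => n.+1%:R^-1); split=> [n|n m nm|]; last exact: invS_small.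
    by rewrite invr_gt0.
  by rewrite lef_pV2 ?posrE // ler_nat ltnS.
have /choice [p pP] : forall n : nat, exists p, forall z, spectrum A z ->
    rnorm (p.[z] - h z) <= r n.
  by move=> n; exact: spectrum_approx.
have pp n m : opbound (polyop A (p n - p m)) (r n + r m).
  apply: polyop_contractive => // z zA; rewrite hornerD hornerN.
  apply: le_trans (rdistD (h z) _ _) _; rewrite (rdistC (h z)).
  exact: lerD (pP n z zA) (pP m z zA).
have /choice [B BP] : forall x, exists l, forall e : R, 0 < e ->
    exists N, forall n, (N <= n)%N -> rnorm (polyop A (p n) x - l) <= e.
  move=> x; apply: cauchy_seq_lim => e e0.
  have [d d0 dE] : exists2 d, 0 < d & d * (2 * rnorm x) + d = e.
    by apply: exists_scale; rewrite ?mulr_ge0 ?rnorm_ge0.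
  have [N NP] := r_small d d0; exists N => n m Nn Nm.
  rewrite -polyopB; apply: le_trans (pp n m x) _.
  have X0 := rnorm_ge0 x.
  have := ler_wpM2r X0 (ltW (NP n Nn)); have := ler_wpM2r X0 (ltW (NP m Nm)).
  by rewrite mulrDl; lra.
(* The limit [B] is only pointwise, but letting [m] grow in [pp] makes the estimate uniform in [x],
   with [r m <= r n]. *)
have pB n : opbound (fun x => polyop A (p n) x - B x) (2 * r n).
  move=> x; apply/ler_addgt0Pr => e e0.
  have [N NP] := BP x e e0; pose m := maxn n N.
  have := NP m (leq_maxr _ _).
  have := pp n m x; rewrite polyopB.
  have /(ler_wpM2r (rnorm_ge0 x)) := r_mono n m (leq_maxl _ _).
  have := rdistD (polyop A (p m) x) (polyop A (p n) x) (B x).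
  by rewrite mulrDl; lra.
exists B; split; last first.
  move=> e e0; have e20 : 0 < e / 2 by rewrite divr_gt0.
  have [N /(_ N (leqnn N)) NP] := r_small _ e20.
  have := r0 N => rN0.
  exists (p N) => [z zA|x].
    by apply: le_trans (pP N z zA) _; lra.
  by apply: le_trans (pB N x) _; rewrite ler_wpM2r ?rnorm_ge0 //; lra.
have bp n := bounded_polyop (p n) A_bounded.
apply/bounded_operatorP; split=> [a x y|].
  apply/eqP; rewrite -subr_eq0 -rnorm_eq0 eq_le rnorm_ge0 andbT.
  apply/ler_addgt0Pr => e e0; rewrite add0r.
  pose K := rnorm (a *: x + y) + rnorm a * rnorm x + rnorm y.
  have K0 : 0 <= K by rewrite !addr_ge0 ?mulr_ge0 ?rnorm_ge0.
  have [d d0 dE] : exists2 d, 0 < d & d * (2 * K) + d = e.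
    by apply: exists_scale; rewrite ?mulr_ge0.
  have [n /(_ n (leqnn n)) nP] := r_small d d0.
  have := pB n (a *: x + y); have := pB n y; have := pB n x.
  rewrite (boundedD _ _ (bp n)) (boundedZ _ _ (bp n)).
  set P := polyop A (p n) => h1 h2 h3.
  have -> : B (a *: x + y) - (a *: B x + B y) =
      - (a *: P x + P y - B (a *: x + y)) + (a *: (P x - B x) + (P y - B y)).
    by rewrite opprB scalerBr [X in _ = _ + X]addrACA -opprD addrA subrK.
  apply: le_trans (rnormD _ _) _; rewrite rnormN.
  apply: le_trans (lerD h3 (rnormD _ _)) _; rewrite rnormZ.
  have := ler_wpM2l (rnorm_ge0 a) h1.
  have := ler_wpM2r K0 (ltW nP); move: dE; rewrite /K; lra.
have /bounded_operatorP [_ [C C0 pC]] := bp 0%N.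
exists (C + 2 * r 0%N) => [|x].
  by rewrite addr_ge0 // mulr_ge0 // ltW.
have := pC x; have := pB 0%N x; rewrite rdistC => h1 h2.
by have := rnorm_lerBr (B x) (polyop A (p 0%N) x); rewrite mulrDl; lra.
Qed.

Lemma approximatesD h k B B' : approximates h B -> approximates k B' ->
  approximates (fun z => h z + k z) (fun x => B x + B' x).
Proof.
move=> [bB hB] [bB' kB']; split; first exact: bounded_operatorD.
move=> e e0; have e20 : 0 < e / 2 by rewrite divr_gt0.
have [p ph pB] := hB _ e20; have [q qk qB] := kB' _ e20.
exists (p + q) => [z zA|x].
  rewrite hornerD opprD addrACA; apply: le_trans (rnormD _ _) _.
  by have := ph z zA; have := qk z zA; lra.
rewrite polyopD opprD addrACA; apply: le_trans (rnormD _ _) _.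
by have := pB x; have := qB x; lra.
Qed.

Lemma approximatesZ (c : R[i]) h B : approximates h B ->
  approximates (fun z => c * h z) (fun x => c *: B x).
Proof.
move=> [bB hB]; split; first exact: bounded_operatorZ.
move=> e e0.
have [d d0 dE] := exists_scale (rnorm_ge0 c) e0.
have de : rnorm c * d <= e by rewrite mulrC; lra.
have [p ph pB] := hB _ d0.
exists (c *: p) => [z zA|x].
  rewrite hornerZ -mulrBr rnormM; apply: le_trans de.
  by rewrite ler_wpM2l ?rnorm_ge0 ?ph.
rewrite polyopZ -scalerBr rnormZ; apply: le_trans (ler_wpM2r (rnorm_ge0 _) de).
by rewrite -mulrA ler_wpM2l ?rnorm_ge0 ?pB.
Qed.

Lemma approximatesM h k B B' : spectrum_continuous A h ->
  spectrum_continuous A k -> approximates h B -> approximates k B' ->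
  approximates (fun z => h z * k z) (B \o B').
Proof.
move=> hc kc [bB hB] [bB' kB']; split; first exact: bounded_operator_comp.
have [c c0 hle] := spectrum_continuous_bounded hc.
have [c' c'0 kle] := spectrum_continuous_bounded kc.
have /bounded_operatorP [_ [C C0 BC]] := bB.
have /bounded_operatorP [_ [C' C'0 B'C]] := bB'.
(* The summand [e] forces [d <= 1], so that the cross terms of size [d * d] are at most [d]. *)
move=> e e0; have K0 : 0 <= c + c' + C + C' + e by rewrite !addr_ge0 ?(ltW e0).
have [d d0 dE] := exists_scale K0 e0.
have d1 : d <= 1.
  have : 0 <= d * (c + c' + C + C') by rewrite mulr_ge0 ?(ltW d0) ?addr_ge0.
  by rewrite leNgt => h1; apply/negP => h2; nra.
have dd : 0 <= d - d * d by nra.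
have := mulr_ge0 (ltW d0) c0; have := mulr_ge0 (ltW d0) c'0.
have := mulr_ge0 (ltW d0) C0; have := mulr_ge0 (ltW d0) C'0.
have := mulr_ge0 (ltW d0) (ltW e0) => de dC' dC dc' dc.
have [p ph pB] := hB d d0; have [q qk qB] := kB' d d0.
exists (p * q) => [z zA|x].
  rewrite hornerM.
  have -> : p.[z] * q.[z] - h z * k z = (p.[z] - h z) * (q.[z] - k z) +
    ((p.[z] - h z) * k z + h z * (q.[z] - k z)) :> R[i] by ring.
  apply: le_trans (rnormD _ _) _; apply: le_trans (lerD (lexx _) (rnormD _ _)) _.
  rewrite !rnormM.
  have h1 := ler_pM (rnorm_ge0 _) (rnorm_ge0 _) (ph z zA) (qk z zA).
  have h2 := ler_pM (rnorm_ge0 _) (rnorm_ge0 _) (ph z zA) (kle z zA).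
  have h3 := ler_pM (rnorm_ge0 _) (rnorm_ge0 _) (hle z zA) (qk z zA).
  by apply: le_trans (lerD h1 (lerD h2 h3)) _; lra.
rewrite polyopM //.
have -> : polyop A p (polyop A q x) - (B \o B') x =
    polyop A p (polyop A q x - B' x) - B (polyop A q x - B' x) +
    (B (polyop A q x - B' x) + (polyop A p (B' x) - B (B' x))).
  rewrite addrA subrK (boundedB _ _ (bounded_polyop p A_bounded)).
  by rewrite addrA subrK.
apply: le_trans (rnormD _ _) _; apply: le_trans (lerD (lexx _) (rnormD _ _)) _.
have h1 := pB (polyop A q x - B' x); have h2 := BC (polyop A q x - B' x).
have h3 := pB (B' x); have h4 := B'C x; have h5 := qB x.
apply: le_trans (lerD h1 (lerD h2 h3)) _.
have h6 := ler_wpM2l (ltW d0) h5; have h7 := ler_wpM2l C0 h5.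
have h8 := ler_wpM2l (ltW d0) h4.
apply: le_trans (lerD h6 (lerD h7 h8)) _.
have X0 := rnorm_ge0 x; have := mulr_ge0 dd X0.
have -> : e * rnorm x = (d * (c + c' + C + C' + e) + d) * rnorm x by rewrite dE.
have := mulr_ge0 (mulr_ge0 (ltW d0) c0) X0.
have := mulr_ge0 (mulr_ge0 (ltW d0) c'0) X0.
have := mulr_ge0 (mulr_ge0 (ltW d0) (ltW e0)) X0.
lra.
Qed.

Lemma approximates_conj h B : approximates h B ->
  approximates (fun z => (h z)^*) (adjoint B).
Proof.
move=> [bB hB]; split; first exact: bounded_adjoint.
move=> e e0; have [p ph pB] := hB e e0.
exists (map_poly Num.conj p) => [z zA|].
  (* At a real point the polynomial with conjugate coefficients takes the conjugate value. *)
  have zE : z = z^*.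
    by rewrite {2}(spectrum_selfadjoint_real A_selfadjoint zA) conj_real
      -(spectrum_selfadjoint_real A_selfadjoint zA).
  by rewrite {1}zE horner_map -rmorphB rnorm_conj ph.
have bpB : bounded_operator (fun x => polyop A p x - B x).
  have -> : (fun x => polyop A p x - B x) = (fun x => polyop A p x + -1 *: B x).
    by apply/funext => x; rewrite scaleN1r.
  apply: bounded_operatorD; first exact: bounded_polyop.
  exact: bounded_operatorZ.
have <- : adjoint (fun x => polyop A p x - B x) =
    (fun x => polyop A (map_poly Num.conj p) x - adjoint B x).
  apply: adjoint_eq => // x y.
  by rewrite innerBl innerBr polyop_adjoint // adjointP.
exact: opbound_adjoint (ltW e0) _.
Qed.

Lemma approximates_poly p : approximates (fun z => p.[z]) (polyop A p).
Proof.
split; first exact: bounded_polyop.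
move=> e e0; exists p => [z _|x].
  by rewrite subrr rnorm0 ltW.
by rewrite subrr rnorm0 mulr_ge0 ?rnorm_ge0 ?ltW.
Qed.

Lemma calculus_exists : exists Phi, is_calculus A Phi.
Proof.
(* For [h] discontinuous on the spectrum [get] may return a default value; [is_calculus] constrains
   only continuous functions. *)
pose Phi (h : R[i]^o -> R[i]^o) : H -> H := get [set B | approximates h B].
have PhiP h : spectrum_continuous A h -> approximates h (Phi h).
  by move=> /approximates_exists /getPex.
have Phi_eq h B : approximates h B -> Phi h = B.
  move=> hB; apply: (approximates_unique _ hB) => //.
  by apply: (@getPex _ [set B | approximates h B]); exists B.
exists Phi; split.
- by move=> h /PhiP [].
- move=> h k hc kc hk; apply: Phi_eq; split; first by case: (PhiP _ kc).
  move=> e e0; have [p ph pB] := (PhiP _ kc).2 e e0.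
  by exists p => // z zA; rewrite hk // ph.
- apply: Phi_eq; have := approximates_poly 1.
  have -> : polyop A 1 = idfun by apply/funext => x; rewrite -polyC1 polyopC scale1r.
  by under [X in approximates X]funext do rewrite hornerC.
- apply: Phi_eq; have := approximates_poly 'X.
  have -> : polyop A 'X = A by apply/funext => x; rewrite polyopX.
  by under [X in approximates X]funext do rewrite hornerX.
- by move=> h k hc kc; apply/Phi_eq/approximatesD; exact: PhiP.
- by move=> c h hc; apply/Phi_eq/approximatesZ; exact: PhiP.
- by move=> h k hc kc; apply/Phi_eq/approximatesM => //; exact: PhiP.
- by move=> h hc; apply/Phi_eq/approximates_conj; exact: PhiP.
Qed.

End CalculusExistence.

(** * Consequences of the calculus axioms *)

Section CalculusProperties.
Variables (R : realType) (H : hilbertType R) (A : H -> H).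
Variable Phi : (R[i]^o -> R[i]^o) -> H -> H.
Hypothesis PhiP : is_calculus A Phi.
Implicit Types (h k : R[i] -> R[i]) (p : {poly R[i]}) (z : R[i]).

Let cst_cont (c : R[i]) : spectrum_continuous A (fun=> c).
Proof. by move=> z; exact: cvg_cst. Qed.

Let id_cont : spectrum_continuous A id.
Proof. by apply: continuous_subspaceT => z; exact: cvg_id. Qed.

Lemma spectrum_continuousD h k : spectrum_continuous A h ->
  spectrum_continuous A k -> spectrum_continuous A (fun z => h z + k z).
Proof.
move=> /subspace_continuousP hc /subspace_continuousP kc.
apply/subspace_continuousP => z zA.
by apply: (@cvgD _ R[i]^o); [exact: hc | exact: kc].
Qed.

Lemma spectrum_continuousM h k : spectrum_continuous A h ->
  spectrum_continuous A k -> spectrum_continuous A (fun z => h z * k z).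
Proof.
move=> /subspace_continuousP hc /subspace_continuousP kc.
apply/subspace_continuousP => z zA.
by apply: (@cvgM R[i]); [exact: hc | exact: kc].
Qed.

Let poly_cont p : spectrum_continuous A (fun z => p.[z]).
Proof.
elim/poly_ind: p => [|p c IH].
  by under eq_fun do rewrite horner0; exact: cst_cont.
under eq_fun do rewrite hornerMXaddC.
exact: (spectrum_continuousD (spectrum_continuousM IH id_cont) (@cst_cont c)).
Qed.

Let Phi_cst (c : R[i]) : Phi (fun=> c) = (fun x => c *: x).
Proof.
have -> : (fun=> c) = (fun _ : R[i]^o => c * 1) by apply/funext => z; rewrite mulr1.
by rewrite (calculus_Z PhiP _ (@cst_cont 1)) (calculus_1 PhiP).
Qed.

Lemma calculus_poly p : Phi (fun z => p.[z]) = polyop A p.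
Proof.
elim/poly_ind: p => [|p c IH].
  under eq_fun do rewrite -polyC0 hornerC.
  by rewrite Phi_cst; apply/funext => x; rewrite -polyC0 polyopC.
under eq_fun do rewrite hornerMXaddC.
have pc := @poly_cont p.
rewrite (calculus_D PhiP (spectrum_continuousM pc id_cont) (@cst_cont c)).
rewrite (calculus_M PhiP pc id_cont) IH (calculus_id PhiP) Phi_cst.
by apply/funext => x; rewrite polyopD polyopMX polyopC.
Qed.

Lemma spectrum_continuous_conj h : spectrum_continuous A h ->
  spectrum_continuous A (fun z => (h z)^*).
Proof.
move=> /within_continuousP hc; apply/within_continuousP => z zA e e0.
have [d d0 dP] := hc z zA e e0; exists d => // w wA zw.
by have := dP w wA zw; rewrite -rnorm_conj [X in rnorm X]rmorphB.
Qed.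

Lemma spectrum_continuous_norm h (F : R -> R) : continuous F ->
  spectrum_continuous A h ->
  spectrum_continuous A (fun z => (F (rnorm (h z)))%:C).
Proof.
move=> Fc /within_continuousP hc; apply/within_continuousP => z zA e e0.
have /cvgrPdist_lt /(_ e e0) /nbhs_normP [r /= r0 rP] := Fc (rnorm (h z)).
have [d d0 dP] := hc z zA r r0; exists d => // w wA zw.
rewrite -[_ - _]/((F (rnorm (h z)))%:C - (F (rnorm (h w)))%:C : R[i]).
rewrite -rmorphB rnorm_real; apply: rP => /=.
apply: le_lt_trans (dP w wA zw); rewrite ler_norml.
have := rnorm_lerBr (h z) (h w); have := rnorm_lerBr (h w) (h z).
rewrite (rdistC (h w)) => h1 h2; apply/andP; split; last exact: h2.
by rewrite lerNl opprB; exact: h1.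
Qed.

(* As [c ^ 2 - |h| ^ 2 = k ^ 2] on the spectrum with k real, the homomorphism
   gives [c ^ 2 |x| ^ 2 - |Phi h x| ^ 2 = |Phi k x| ^ 2 >= 0]. *)
Lemma calculus_contractive h (c : R) : spectrum_continuous A h -> 0 <= c ->
  (forall z, spectrum A z -> rnorm (h z) <= c) -> opbound (Phi h) c.
Proof.
move=> hc c0 hle x.
(* [Num.sqrt] is 0 on negative numbers, so [F] is continuous on all of R; on the spectrum the
   radicand is nonnegative. *)
pose F (t : R) := Num.sqrt (c ^+ 2 - t ^+ 2).
have Fc : continuous F.
  move=> t; have gt : (fun s : R => c ^+ 2 - s ^+ 2) @ t --> c ^+ 2 - t ^+ 2.
    by apply: cvgB; [exact: cvg_cst | exact: exprn_continuous].
  exact: (cvg_comp _ _ gt (@sqrt_continuous R _)).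
pose k z : R[i] := (F (rnorm (h z)))%:C.
have kc : spectrum_continuous A k by exact: spectrum_continuous_norm.
have hcc := spectrum_continuous_conj hc.
have bh := calculus_bounded PhiP hc; have bk := calculus_bounded PhiP kc.
have adj_k : adjoint (Phi k) = Phi k.
  rewrite -(calculus_conj PhiP kc); congr Phi.
  by apply/funext => z; rewrite conj_real.
have hhc := spectrum_continuousM hcc hc.
have kkc := spectrum_continuousM kc kc.
have : Phi (fun z => (h z)^* * h z + k z * k z) = Phi (fun=> (c ^+ 2)%:C).
  apply: (calculus_ext PhiP (spectrum_continuousD hhc kkc) (@cst_cont _)) => z zA.
  rewrite -[LHS]/((h z)^* * h z + k z * k z : R[i]).
  rewrite mulrC -sqr_rnorm -rmorphM -expr2 sqr_sqrtr; last first.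
    by rewrite subr_ge0 ler_pXn2r ?nnegrE ?rnorm_ge0 // hle.
  by rewrite -rmorphD /= addrC subrK.
rewrite (calculus_D PhiP hhc kkc) (calculus_M PhiP hcc hc) (calculus_M PhiP kc kc).
rewrite (calculus_conj PhiP hc) Phi_cst -{1}adj_k => /(congr1 (fun T => T x)) /=.
move=> /(congr1 (fun y => inner y x : R[i])).
rewrite innerDl innerZl !adjointPl // !inner_self -rmorphD -rmorphM.
move=> /complexI E; rewrite -(@ler_pXn2r _ 2) ?nnegrE ?rnorm_ge0 ?mulr_ge0 ?rnorm_ge0 //.
by rewrite exprMn -E lerDl sqr_ge0.
Qed.

(** This ties an arbitrary calculus back to polynomials, so that one polynomial can compare the
    calculi of two operators. *)
Lemma calculus_approx h p (e : R) : spectrum_continuous A h -> 0 <= e ->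
  (forall z, spectrum A z -> rnorm (p.[z] - h z) <= e) ->
  opbound (fun x => polyop A p x - Phi h x) e.
Proof.
move=> hc e0 ph.
have h1c : spectrum_continuous A (fun z => -1 * h z).
  exact: (spectrum_continuousM (@cst_cont (-1)) hc).
have phc := spectrum_continuousD (@poly_cont p) h1c.
have -> : (fun x => polyop A p x - Phi h x) = Phi (fun z => p.[z] + -1 * h z).
  rewrite (calculus_D PhiP (@poly_cont p) h1c) calculus_poly (calculus_Z PhiP _ hc).
  by apply/funext => x; rewrite scaleN1r.
by apply: calculus_contractive => // z zA; rewrite mulN1r ph.
Qed.

End CalculusProperties.

(** * Real functions of positive operators *)

Section RealCalculus.
Variables (R : realType) (H : hilbertType R).
Implicit Types (A B T : H -> H) (f g : R -> R).

Local Notation half_line := (`[0, +oo[%classic : set R).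

Lemma calculusP A : positive A -> is_calculus A (calculus A).
Proof. by move=> /calculus_exists /getPex. Qed.

Lemma spectrum_positive_real A z : positive A -> spectrum A z ->
  z = (complex.Re z)%:C /\ 0 <= complex.Re z.
Proof.
move=> pA zA; have zE := spectrum_selfadjoint_real pA.1 zA; split=> //.
have [M _ AM] := spectrum_positive_bound pA.
by rewrite zE in zA; have /andP[] := AM _ zA.
Qed.

Lemma half_line_spectrum_continuous A f : positive A ->
  {within half_line, continuous f} ->
  spectrum_continuous A (fun z => (f (complex.Re z))%:C).
Proof.
move=> pA /within_realP fc; apply/within_continuousP => z zA e e0.
have [zE z0] := spectrum_positive_real pA zA.
have [|d d0 dP] := fc (complex.Re z) _ e e0; first by rewrite /= in_itv /= z0.
exists d => // w wA zw; have [wE w0] := spectrum_positive_real pA wA.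
rewrite -[_ - _]/((f (complex.Re z))%:C - (f (complex.Re w))%:C : R[i]).
rewrite -rmorphB rnorm_real; apply: dP; first by rewrite /= in_itv /= w0.
apply: le_lt_trans zw; rewrite -raddfB; exact: Re_rnorm.
Qed.

Section Rules.
Variable A : H -> H.
Hypothesis A_positive : positive A.
Variables f g : R -> R.
Hypotheses (f_cont : {within half_line, continuous f})
  (g_cont : {within half_line, continuous g}).

Let fc := half_line_spectrum_continuous A_positive f_cont.
Let gc := half_line_spectrum_continuous A_positive g_cont.
Let AP := calculusP A_positive.

Lemma real_calculus_bounded : bounded_operator (real_calculus A f).
Proof. exact: (calculus_bounded AP fc). Qed.

Lemma real_calculus_selfadjoint : selfadjoint (real_calculus A f).
Proof.
split=> [|x y]; first exact: real_calculus_bounded.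
rewrite (adjointP real_calculus_bounded) -(calculus_conj AP fc).
by under [in calculus A _]eq_fun do rewrite conj_real.
Qed.

Lemma real_calculusD : real_calculus A (fun t => f t + g t) =
  (fun x => real_calculus A f x + real_calculus A g x).
Proof.
by rewrite -(calculus_D AP fc gc); congr calculus; apply/funext => z; rewrite rmorphD.
Qed.

Lemma real_calculusM : real_calculus A (fun t => f t * g t) =
  real_calculus A f \o real_calculus A g.
Proof.
by rewrite -(calculus_M AP fc gc); congr calculus; apply/funext => z; rewrite rmorphM.
Qed.

Lemma eq_real_calculus : (forall t, 0 <= t -> f t = g t) ->
  real_calculus A f = real_calculus A g.
Proof.
move=> fg; apply: (calculus_ext AP fc gc) => z zA.
by have [_ z0] := spectrum_positive_real A_positive zA; rewrite fg.
Qed.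

Lemma real_calculus_contractive (c : R) : 0 <= c ->
  (forall t, 0 <= t -> `|f t| <= c) -> opbound (real_calculus A f) c.
Proof.
move=> c0 fle; apply: (calculus_contractive AP fc c0) => z zA.
have [_ z0] := spectrum_positive_real A_positive zA.
by rewrite rnorm_real fle.
Qed.

Lemma real_calculus_id : (forall t, 0 <= t -> f t = t) -> real_calculus A f = A.
Proof.
move=> fE; have id_cont : spectrum_continuous A (fun z => z).
  by apply: continuous_subspaceT => z; exact: cvg_id.
rewrite -[RHS](calculus_id AP); apply: (calculus_ext AP fc id_cont) => z zA.
have [zE z0] := spectrum_positive_real A_positive zA.
by rewrite fE // -zE.
Qed.

Lemma real_calculus_1 : (forall t, f t = 1) -> real_calculus A f = idfun.
Proof.
move=> fE; rewrite -[RHS](calculus_1 AP); congr calculus.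
by apply/funext => z; rewrite fE rmorph1.
Qed.

End Rules.

(** [T] intertwines p(A) and p(B) for every polynomial p. Both spectra lie in [[0, M + M']], so one
    p approximates [f] on both. *)
Lemma real_calculus_intertwine A B T f : positive A -> positive B ->
  bounded_operator T -> (forall x, T (A x) = B (T x)) ->
  {within half_line, continuous f} ->
  forall x, T (real_calculus A f x) = real_calculus B f (T x).
Proof.
move=> pA pB bT TAB f_cont x.
have [M M0 AM] := spectrum_positive_bound pA.
have [M' M'0 BM] := spectrum_positive_bound pB.
pose K := (`[0, M + M']%classic : set R).
have K_cont t : K t -> forall d : R, 0 < d -> exists2 r : R, 0 < r &
    forall s, K s -> `|t - s| < r -> rnorm ((f t)%:C - (f s)%:C : R[i]) < d.
  rewrite /K /= in_itv /= => /andP[t0 _] d d0.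
  have [|r r0 rP] := within_realP f_cont (x := t) _ d0; first by rewrite /= in_itv /= t0.
  exists r => // s; rewrite /= in_itv /= => /andP[s0 _] ts.
  by rewrite -rmorphB rnorm_real; apply: rP => //; rewrite /= in_itv /= s0.
have [C C0 TC] : exists2 C, 0 <= C & opbound T C.
  by have /bounded_operatorP [] := bT.
apply/eqP; rewrite -subr_eq0 -rnorm_eq0 eq_le rnorm_ge0 andbT.
apply/ler_addgt0Pr => e e0; rewrite add0r.
have K0 : 0 <= C * rnorm x + rnorm (T x) by rewrite addr_ge0 ?mulr_ge0 ?rnorm_ge0.
have [d d0 dE] := exists_scale K0 e0.
have [|p pP] := @Weierstrass_compact R K (M + M') (fun t => (f t)%:C) d
  (@segment_compact _ _ _) _ K_cont d0.
  by move=> t; rewrite /K /= in_itv.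
have approx (S : H -> H) : positive S ->
    (forall t : R, spectrum S t%:C -> 0 <= t <= M + M') ->
    opbound (fun x => polyop S p x - real_calculus S f x) d.
  move=> pS SM; have fc := half_line_spectrum_continuous pS f_cont.
  apply: (calculus_approx (calculusP pS) fc (ltW d0)) => z zS.
  have [zE z0] := spectrum_positive_real pS zS.
  rewrite zE; apply: pP; rewrite /K /= in_itv /=; apply: SM.
  by rewrite -zE.
have h1 : opbound (fun x => polyop A p x - real_calculus A f x) d.
  by apply: approx => // t /AM /andP[-> h]; rewrite (le_trans h) // lerDl.
have h2 : opbound (fun x => polyop B p x - real_calculus B f x) d.
  by apply: approx => // t /BM /andP[-> h]; rewrite (le_trans h) // lerDr.
apply: le_trans (rdistD (polyop B p (T x)) _ _) _.
have := h2 (T x); rewrite -(@polyop_intertwine _ _ T A B) // => h3.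
have := TC (polyop A p x - real_calculus A f x); rewrite boundedB // rdistC => h4.
have h5 := ler_wpM2l C0 (h1 x).
by apply: le_trans (lerD h4 h3) _; lra.
Qed.

End RealCalculus.

(** * Mixed Schwarz inequality *)

Section WithinContinuous.
Variables (R : realType) (D : set R) (f g : R -> R).
Hypotheses (f_cont : {within D, continuous f}) (g_cont : {within D, continuous g}).

Lemma within_continuousD : {within D, continuous (fun t => f t + g t)}.
Proof.
move: f_cont g_cont => /subspace_continuousP fc /subspace_continuousP gc.
apply/subspace_continuousP => t Dt.
by apply: (@cvgD _ R); [exact: fc | exact: gc].
Qed.

Lemma within_continuousM : {within D, continuous (fun t => f t * g t)}.
Proof.
move: f_cont g_cont => /subspace_continuousP fc /subspace_continuousP gc.
apply/subspace_continuousP => t Dt.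
by apply: (@cvgM R); [exact: fc | exact: gc].
Qed.

End WithinContinuous.

Section AbsoluteValue.
Variables (R : realType) (H : hilbertType R) (T : H -> H).
Hypothesis T_bounded : bounded_operator T.
Implicit Types (f g : R -> R) (x y : H).

Local Notation half_line := (`[0, +oo[%classic : set R).

Let within_continuous f : continuous f -> {within half_line, continuous f}.
Proof. exact: continuous_subspaceT. Qed.

Let sqrt_cont : {within half_line, continuous (@Num.sqrt R)}.
Proof. by apply: within_continuous; exact: sqrt_continuous. Qed.

Lemma positive_adjoint_comp : positive (adjoint T \o T).
Proof.
have bT' := bounded_adjoint T_bounded.
split; last by move=> x; rewrite /= adjointPl // -rnorm_sqr sqr_ge0.
split; first exact: bounded_operator_comp.
by move=> x y; rewrite /= adjointPl // adjointP.
Qed.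

Lemma absop_sqr x : absop T (absop T x) = adjoint T (T x).
Proof.
have pT := positive_adjoint_comp.
have sqrt_sqr := within_continuousM sqrt_cont sqrt_cont.
have sqr_id : real_calculus (adjoint T \o T) _ = _ :=
  real_calculus_id pT sqrt_sqr (fun t t0 => etrans (esym (expr2 _)) (sqr_sqrtr t0)).
by have := congr1 (fun S => S x) sqr_id; rewrite real_calculusM.
Qed.

Lemma positive_absop : positive (absop T).
Proof.
have pT := positive_adjoint_comp.
(* |T| is the square of the selfadjoint fourth root of [T^* T], hence positive. *)
have s4_cont : {within half_line, continuous (fun t : R => Num.sqrt (Num.sqrt t))}.
  apply: within_continuous => t.
  by apply: (@continuous_cvg _ _ _ (nbhs t) _ Num.sqrt); exact: sqrt_continuous.
split=> [|x]; first exact: real_calculus_selfadjoint.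
have [_ sS] := real_calculus_selfadjoint pT s4_cont.
have -> : absop T = real_calculus (adjoint T \o T)
    (fun t => Num.sqrt (Num.sqrt t) * Num.sqrt (Num.sqrt t)).
  apply: eq_real_calculus => //; first exact: within_continuousM.
  by move=> t t0; rewrite -expr2 sqr_sqrtr // sqrtr_ge0.
by rewrite real_calculusM //= sS -rnorm_sqr sqr_ge0.
Qed.

Lemma rnorm_absop x : rnorm (absop T x) = rnorm (T x).
Proof.
have [[_ sP] _] := positive_absop.
apply/eqP; rewrite -(@eqrXn2 _ 2) ?rnorm_ge0 //.
by rewrite !rnorm_sqr -sP absop_sqr adjointPl.
Qed.

End AbsoluteValue.

Section MixedSchwarz.
Variables (R : realType) (H : hilbertType R) (T : H -> H).
Hypothesis T_bounded : bounded_operator T.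
Implicit Types (f g : R -> R) (x y : H).

Local Notation half_line := (`[0, +oo[%classic : set R).

(** [T] intertwines [T^* T] and [T T^*], hence also their square roots. *)
Lemma absop_intertwine x : T (absop T x) = absop (adjoint T) (T x).
Proof.
have bT' := bounded_adjoint T_bounded.
apply: real_calculus_intertwine => //; first exact: positive_adjoint_comp.
- exact: positive_adjoint_comp.
- by move=> y; rewrite /= adjointK.
- by apply: continuous_subspaceT; exact: sqrt_continuous.
Qed.

(* With [k t = 1 / (t + e)] the operator [V = T k(|T|)] is a contraction
   standing in for the partial isometry of the polar decomposition:
   [g(|T^*|) V f(|T|) = T |T| k(|T|)] is within [e] of [T]. *)
Lemma mixed_Schwarz f g x y :
  {within half_line, continuous f} -> {within half_line, continuous g} ->
  (forall t : R, 0 <= t -> f t * g t = t) ->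
  rnorm (inner (T x) y : R[i]) <=
    rnorm (real_calculus (absop T) f x) *
    rnorm (real_calculus (absop (adjoint T)) g y).
Proof.
move=> f_cont g_cont fg.
have pA := positive_absop T_bounded.
have pB := positive_absop (bounded_adjoint T_bounded).
set A := absop T in pA *; set B := absop _ in pB *.
apply/ler_addgt0Pr => e' e'0.
have K0 : 0 <= rnorm x * rnorm y by rewrite mulr_ge0 ?rnorm_ge0.
have [e e0 eE] := exists_scale K0 e'0.
(* The absolute value makes [k] continuous on the whole line. *)
pose k (t : R) := (`|t| + e)^-1.
have k_pos t : 0 < `|t| + e by rewrite ltr_wpDl.
have k_cont : {within half_line, continuous k}.
  apply: continuous_subspaceT => t; apply: cvgV; first by rewrite gt_eqF.
  by apply: cvgD; [apply: cvg_norm; exact: cvg_id | exact: cvg_cst].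
have cst_cont (c : R) : {within half_line, continuous (fun=> c)}.
  by apply: continuous_subspaceT => t; exact: cvg_cst.
have id_cont : {within half_line, continuous (@id R)}.
  by apply: continuous_subspaceT => t; exact: cvg_id.
have kf_cont := within_continuousM k_cont f_cont.
have ek_cont := within_continuousM (cst_cont e) k_cont.
have gkf_cont := within_continuousM g_cont kf_cont.
have idk_cont := within_continuousM id_cont k_cont.
have idek_cont := within_continuousM id_cont ek_cont.
(* On the half-line [g k f + e k = (t + e) / (t + e) = 1]. *)
have one : real_calculus A (fun t => g t * (k t * f t) + e * k t) = idfun.
  rewrite -(real_calculus_1 (f := fun=> 1) pA) //.
  apply: (eq_real_calculus pA (within_continuousD gkf_cont ek_cont)) => // t t0.
  rewrite mulrCA [g t * _]mulrC fg // /k ger0_norm //.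
  by rewrite mulrC -mulrDl divff // gt_eqF // ltr_wpDl.
have TA z : rnorm (T z) = rnorm (A z) by rewrite rnorm_absop.
have AE : real_calculus A id = A by exact: real_calculus_id.
have V_contr z : rnorm (T (real_calculus A k z)) <= rnorm z.
  rewrite TA -{1}AE -[X in rnorm X]/((real_calculus A id \o _) z).
  rewrite -real_calculusM // -[X in _ <= X]mul1r.
  apply: real_calculus_contractive => // t t0.
  rewrite normrM /k (ger0_norm t0) ger0_norm ?invr_ge0 ?addr_ge0 ?(ltW e0) //.
  by rewrite ler_pdivrMr ?ltr_wpDl // mul1r lerDl ltW.
have rest : rnorm (T (real_calculus A (fun t => e * k t) x)) <= e * rnorm x.
  rewrite TA -{1}AE -[X in rnorm X]/((real_calculus A id \o _) x).
  rewrite -real_calculusM //.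
  apply: real_calculus_contractive => //; first exact: ltW.
  move=> t t0; rewrite mulrCA /k (ger0_norm t0) normrM (gtr0_norm e0).
  rewrite ger_pMr // ger0_norm ?divr_ge0 ?addr_ge0 ?(ltW e0) //.
  by rewrite ler_pdivrMr ?ltr_wpDl // mul1r lerDl ltW.
(* [T] is applied to the decomposition [one], and [absop_intertwine] moves g(|T|) across [T], where
   it becomes g(|T^*|). *)
have TE : T x = real_calculus B g (T (real_calculus A k (real_calculus A f x))) +
    T (real_calculus A (fun t => e * k t) x).
  rewrite -(@real_calculus_intertwine _ _ A B T) //; last first.
    by move=> z; exact: absop_intertwine.
  have -> : real_calculus A g (real_calculus A k (real_calculus A f x)) =
      real_calculus A (fun t => g t * (k t * f t)) x.
    by rewrite !real_calculusM.
  rewrite -boundedD //.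
  by have := congr1 (fun S => S x) one; rewrite real_calculusD //= => ->.
rewrite {1}TE innerDl (real_calculus_selfadjoint pB g_cont).2.
apply: le_trans (rnormD _ _) _; apply: lerD.
  apply: le_trans (Cauchy_Schwarz _ _) _.
  by rewrite ler_wpM2r ?rnorm_ge0 ?V_contr.
apply: le_trans (Cauchy_Schwarz _ _) _.
apply: le_trans (ler_wpM2r (rnorm_ge0 _) rest) _; rewrite -mulrA; lra.
Qed.

End MixedSchwarz.

(** * Operator norm and numerical radius *)

Section OperatorNorm.
Variables (R : realType) (H : hilbertType R).
Implicit Types (Q : H -> H) (x : H).

Lemma opnorm_ge Q x : bounded_operator Q -> rnorm x <= 1 -> rnorm (Q x) <= opnorm Q.
Proof.
move=> /bounded_operatorP [_ [C C0 QC]] x1; apply: ub_le_sup; last by exists x.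
exists C => _ [y /= y1 <-]; apply: le_trans (QC y) _.
by rewrite ler_piMr.
Qed.

Lemma opnorm_ge0 Q : bounded_operator Q -> 0 <= opnorm Q.
Proof.
move=> bQ; apply: le_trans (rnorm_ge0 (Q 0)) _.
by apply: opnorm_ge; rewrite // rnorm0.
Qed.

Lemma opnorm_bound Q : bounded_operator Q -> opbound Q (opnorm Q).
Proof.
move=> bQ x; have [->|x_neq0] := eqVneq x 0.
  by rewrite bounded0 // !rnorm0 mulr0.
have n0 : 0 < rnorm x by rewrite rnorm_gt0.
have := @opnorm_ge Q _ bQ (_ : rnorm ((rnorm x)^-1%:C *: x) <= 1).
rewrite rnorm_unit // lexx => /(_ isT).
by rewrite boundedZ // rnormZ rnorm_real gtr0_norm ?invr_gt0 // ler_pdivrMl // mulrC.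
Qed.

(** The condition [0 <= c] covers the empty set, whose [sup] is 0: the unit sphere of the zero space
    is empty. *)
Lemma sup_le_ge0 (E : set R) (c : R) : 0 <= c -> ubound E c -> sup E <= c.
Proof.
move=> c0 Ec; have [E0|nE] := pselect (E !=set0); first exact: ge_sup.
by rewrite sup_out // => -[].
Qed.

Lemma sup_ge0 (E : set R) : (forall t, E t -> 0 <= t) -> 0 <= sup E.
Proof.
move=> E0; have [[[t Et] ubE]|nE] := pselect (has_sup E).
  by apply: le_trans (E0 t Et) _; exact: ub_le_sup.
by rewrite sup_out.
Qed.

End OperatorNorm.

Section NumericalRadius.
Variables (R : realType) (H : hilbertType R) (T A : H -> H).
Hypotheses (T_bounded : bounded_operator T) (A_selfadjoint : selfadjoint A).
Hypothesis inner_le : forall x, rnorm (inner (T x) x : R[i]) <=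
  2^-1 * complex.Re (inner (A x) x : R[i]).
Variables a b : R.
Hypotheses (a_ge0 : 0 <= a) (b_ge0 : 0 <= b).

(** [A] is left abstract so that it can be the sum of f^2(|T|) and g^2(|T^*|) for (i) and |T| +
    |T^*| for (ii). *)
Let Q : H -> H := (a / 4)%:C *: (A \o A) + b%:C *: (adjoint T \o T).

Lemma bounded_weighted_sum : bounded_operator Q.
Proof.
have [bA _] := A_selfadjoint; have bT' := bounded_adjoint T_bounded.
by apply: bounded_operatorD; apply: bounded_operatorZ; exact: bounded_operator_comp.
Qed.

Lemma weighted_inner_le x : rnorm x = 1 ->
  a * rnorm (inner (T x) x : R[i]) ^+ 2 + b * rnorm (T x) ^+ 2 <= opnorm Q.
Proof.
move=> x1; have [_ sA] := A_selfadjoint.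
have bQ := bounded_weighted_sum.
have QE : complex.Re (inner (Q x) x : R[i]) =
    a / 4 * rnorm (A x) ^+ 2 + b * rnorm (T x) ^+ 2.
  rewrite -[Q x]/((a / 4)%:C *: A (A x) + b%:C *: adjoint T (T x)).
  by rewrite innerDl !innerZl sA adjointPl // !inner_self -!rmorphM -rmorphD.
have Q_le : complex.Re (inner (Q x) x : R[i]) <= opnorm Q.
  apply: le_trans (ler_norm _) (le_trans (Re_rnorm _) _).
  apply: le_trans (Cauchy_Schwarz _ _) _.
  by rewrite x1 mulr1 opnorm_ge // x1.
apply: le_trans Q_le; rewrite QE lerD2r -mulrA ler_wpM2l //.
have le_half : rnorm (inner (T x) x : R[i]) <= 2^-1 * rnorm (A x).
  apply: le_trans (inner_le x) _; rewrite ler_wpM2l ?invr_ge0 //.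
  apply: le_trans (ler_norm _) (le_trans (Re_rnorm _) _).
  by apply: le_trans (Cauchy_Schwarz _ _) _; rewrite x1 mulr1.
have -> : 4^-1 = 2^-1 ^+ 2 :> R by field.
by rewrite -exprMn ler_pXn2r ?nnegrE ?mulr_ge0 ?rnorm_ge0 ?invr_ge0.
Qed.

Lemma alpha_beta_norm_le : alpha_beta_norm a b T ^+ 2 <= opnorm Q.
Proof.
have Q0 := opnorm_ge0 bounded_weighted_sum.
rewrite -[leRHS]sqr_sqrtr // ler_pXn2r ?nnegrE ?sqrtr_ge0 //; last first.
  by apply: sup_ge0 => _ [x _ <-]; exact: sqrtr_ge0.
apply: sup_le_ge0; first exact: sqrtr_ge0.
by move=> _ [x /= x1 <-]; rewrite ler_wsqrtr // weighted_inner_le.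
Qed.

(** Since [|T x| >= |<T x, x>|] for unit [x], the left side of [weighted_inner_le] is at least
    [(a + b) |<T x, x>|^2]. *)
Lemma numerical_radius_le : 0 < a + b ->
  numerical_radius T <= (Num.sqrt (a + b))^-1 * Num.sqrt (opnorm Q).
Proof.
move=> ab0; apply: sup_le_ge0.
  by rewrite mulr_ge0 ?invr_ge0 ?sqrtr_ge0.
move=> _ [x /= x1 <-].
rewrite ler_pdivlMl ?sqrtr_gt0 // -[X in _ * X]ger0_norm ?rnorm_ge0 //.
rewrite -sqrtr_sqr -sqrtrM ?(ltW ab0) // ler_wsqrtr //.
apply: le_trans (weighted_inner_le x1); rewrite mulrDl lerD2l ler_wpM2l //.
rewrite ler_pXn2r ?nnegrE ?rnorm_ge0 //.
by apply: le_trans (Cauchy_Schwarz _ _) _; rewrite x1 mulr1.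
Qed.

End NumericalRadius.

Lemma inner_le_half_sum (R : realType) (H : hilbertType R) (T : H -> H)
    (f g : R -> R) (x : H) : bounded_operator T ->
  {within `[0, +oo[, continuous f} -> {within `[0, +oo[, continuous g} ->
  (forall t : R, 0 <= t -> f t * g t = t) ->
  rnorm (inner (T x) x : R[i]) <= 2^-1 * complex.Re (inner
    ((real_calculus (absop T) (fun t => f t ^+ 2)
      + real_calculus (absop (adjoint T)) (fun t => g t ^+ 2)) x) x : R[i]).
Proof.
move=> bT f_cont g_cont fg.
have pA := positive_absop bT.
have pB := positive_absop (bounded_adjoint bT).
have sqrE (S : H -> H) (h : R -> R) : positive S ->
    {within `[0, +oo[, continuous h} ->
    complex.Re (inner (real_calculus S (fun t => h t ^+ 2) x) x : R[i]) =
    rnorm (real_calculus S h x) ^+ 2.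
  move=> pS hc; have [_ sS] := real_calculus_selfadjoint pS hc.
  have -> : (fun t => h t ^+ 2) = (fun t => h t * h t).
    by apply/funext => t; rewrite expr2.
  by rewrite real_calculusM //= sS rnorm_sqr.
rewrite -[(_ + _) x]/(real_calculus _ _ x + real_calculus _ _ x).
rewrite innerDl raddfD /= (sqrE _ f) // (sqrE _ g) //.
apply: le_trans (mixed_Schwarz bT x x f_cont g_cont fg) _.
move: (rnorm _) (rnorm _) => u v; have := sqr_ge0 (u - v); rewrite sqrrB; lra.
Qed.

Lemma selfadjointD (R : realType) (H : hilbertType R) (A B : H -> H) :
  selfadjoint A -> selfadjoint B -> selfadjoint (A + B).
Proof.
move=> [bA sA] [bB sB]; split; first exact: bounded_operatorD.
move=> x y; rewrite -[(A + B) x]/(A x + B x) -[(A + B) y]/(A y + B y).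
by rewrite innerDl innerDr sA sB.
Qed.

Theorem theorem2p19 (R : realType) (H : hilbertType R) (T : H -> H)
  (T_bounded : bounded_operator T) (f g : R -> R)
  (f_ge0 : forall t : R, 0 <= t -> 0 <= f t)
  (g_ge0 : forall t : R, 0 <= t -> 0 <= g t)
  (f_cont : {within `[0, +oo[, continuous f})
  (g_cont : {within `[0, +oo[, continuous g})
  (fg : forall t : R, 0 <= t -> f t * g t = t) :
  (forall a b : R, 0 <= a -> 0 <= b -> (a, b) != (0, 0) ->
     let A := real_calculus (absop T) (fun t => f t ^+ 2)
              + real_calculus (absop (adjoint T)) (fun t => g t ^+ 2) in
     alpha_beta_norm a b T ^+ 2
       <= opnorm ((a / 4)%:C *: (A \o A) + b%:C *: (adjoint T \o T)))
  /\
  (let P := absop T + absop (adjoint T) in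
   let m := inf [set (Num.sqrt (ab.1 + ab.2))^-1 *
                     Num.sqrt (opnorm ((ab.1 / 4)%:C *: (P \o P)
                                       + ab.2%:C *: (adjoint T \o T)))
                | ab in [set ab : R * R | [/\ 0 <= ab.1, 0 <= ab.2
                                             & ab != (0, 0)]]] in
   numerical_radius T <= m /\ m <= 2^-1 * opnorm P).
Proof.
have pA := positive_absop T_bounded.
have pB := positive_absop (bounded_adjoint T_bounded).
split=> [a b a0 b0 _|P m].
  cbv zeta.
  have sqr_cont (h : R -> R) : {within `[0, +oo[, continuous h} ->
      {within `[0, +oo[, continuous (fun t => h t ^+ 2)}.
    by move=> hc; exact: (within_continuousM hc hc).
  apply: alpha_beta_norm_le => //; last by move=> x; exact: inner_le_half_sum.
  by apply: selfadjointD; apply: real_calculus_selfadjoint => //; exact: sqr_cont.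
have sqrt_cont : {within `[0, +oo[, continuous (@Num.sqrt R)}.
  by apply: continuous_subspaceT; exact: sqrt_continuous.
have sqrt_sqr_cont : {within `[0, +oo[, continuous (fun t : R => Num.sqrt t ^+ 2)}.
  exact: (within_continuousM sqrt_cont sqrt_cont).
have sP : selfadjoint P by apply: selfadjointD; [case: pA | case: pB].
have T_le x : rnorm (inner (T x) x : R[i]) <= 2^-1 * complex.Re (inner (P x) x : R[i]).
  have := @inner_le_half_sum R H T Num.sqrt Num.sqrt x T_bounded sqrt_cont sqrt_cont.
  (* The square of [Num.sqrt t] is [t] only for [t >= 0], so the two functions are identified
     through the calculus of a positive operator. *)
  rewrite !(real_calculus_id _ sqrt_sqr_cont) //; first last.
    - by move=> t; exact: sqr_sqrtr.
    - by move=> t; exact: sqr_sqrtr.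
  by apply=> t t0; rewrite -expr2 sqr_sqrtr.
have P0 := opnorm_ge0 sP.1.
have weight10 : [/\ 0 <= (1 : R), 0 <= (0 : R) & ((1, 0) : R * R) != (0, 0)].
  by rewrite ler01 xpair_eqE oner_eq0.
split.
  apply: lb_le_inf; first by apply: image_nonempty; exists (1, 0).
  move=> _ [[a b] /= [a0 b0 ab0] <-]; apply: numerical_radius_le => //.
  rewrite lt_neqAle addr_ge0 // andbT eq_sym; apply: contraNneq ab0 => ab.
  by rewrite xpair_eqE -(paddr_eq0 a0 b0) ab eqxx.
(* At the weight (1, 0) the operator is [P^2 / 4], whose norm is at most [(|P| / 2)^2], with |P| the
   operator norm. *)
apply: le_trans (_ : (Num.sqrt (1 + 0))^-1 * Num.sqrt (opnorm
    ((1 / 4)%:C *: (P \o P) + 0%:C *: (adjoint T \o T))) <= _); last first.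
  rewrite addr0 sqrtr1 invr1 mul1r -[leRHS]ger0_norm ?mulr_ge0 ?invr_ge0 //.
  rewrite -sqrtr_sqr ler_wsqrtr //; apply: sup_le_ge0; first exact: sqr_ge0.
  move=> _ [x /= x1 <-].
  rewrite -[(_ + _) x]/((1 / 4)%:C *: P (P x) + 0%:C *: adjoint T (T x)).
  rewrite scale0r addr0 rnormZ rnorm_real ger0_norm ?divr_ge0 //.
  have -> : (2^-1 * opnorm P) ^+ 2 = 1 / 4 * (opnorm P * opnorm P) by field.
  rewrite ler_wpM2l ?divr_ge0 // (le_trans (opnorm_bound sP.1 _)) //.
  exact: ler_wpM2l P0 _ _ (opnorm_ge sP.1 x1).
apply: ge_inf; last first.
  by exists (1, 0).
exists 0 => _ [ab _ <-].
by rewrite mulr_ge0 ?invr_ge0 ?sqrtr_ge0.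
Qed.
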